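(* Let $m=m_n$ be positive integers with $m/n\to1$ as $n\to\infty$. Let $\mathbf{X}_n$ be an $n\times m$ random matrix whose rows are i.i.d. $m$-variate Gaussian vectors with mean zero and covariance matrix the identity, and let $\mathbf{B}_n$ be a (deterministic, real) symmetric idempotent $n\times n$ matrix with $\frac{\mathrm{rank}(\mathbf{B}_n)}{n}\to p\in(0,1)$. Then the two matrices $\frac1n\mathbf{X}_n^\top\mathbf{B}_n\mathbf{X}_n$ and $\frac1n\mathbf{X}_n^\top(\mathbf{I}_n-\mathbf{B}_n)\mathbf{X}_n$ converge jointly, as $n\to\infty$, to two freely independent standard free Poisson variables with rates $p$ and $1-p$, respectively.
   Context: A non-commutative probability space is a pair $(\mathcal{A},\varphi)$ with $\mathcal{A}$ a unital algebra over $\mathbb{C}$ and $\varphi:\mathcal{A}\to\mathbb{C}$ linear with $\varphi(\mathbf{1}_{\mathcal{A}})=1$. The $m\times m$ random matrices with entries having all moments finite form such a space with state $A\mapsto\mathbb{E}\frac1m\mathrm{Tr}(A)$. Joint convergence of a pair $(A_n,B_n)$ of such matrices to $(\mathfrak{a},\mathfrak{b})$ in $(\mathcal{A},\varphi)$ means $\mathbb{E}\frac1m\mathrm{Tr}(P(A_n,B_n))\to\varphi(P(\mathfrak{a},\mathfrak{b}))$ for every non-commutative polynomial $P$ in two variables. Unital subalgebras $(\mathcal{A}_i)_{i\in I}$ are freely independent if $\varphi(a_1\cdots a_k)=0$ whenever $k\ge1$, $a_j\in\mathcal{A}_{i_j}$, $\varphi(a_j)=0$ for all $j$, and $i_1\ne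 i_2,\ldots,i_{k-1}\ne i_k$. Elements are free if the unital subalgebras they generate are free. Free cumulants $\kappa_n:\mathcal{A}^n\to\mathbb{C}$ are the multilinear functionals determined by $\varphi(a_1\cdots a_n)=\sum_{\pi\in NC(n)}\prod_{V\in\pi}\kappa_{|V|}(a_{i}:i\in V)$ (indices in each block in increasing order), $NC(n)$ being the set of non-crossing partitions of $\{1,\ldots,n\}$; $\kappa_n(a):=\kappa_n(a,\ldots,a)$. A variable $\mathfrak{p}$ is standard free Poisson with rate $\lambda>0$ if $\kappa_n(\mathfrak{p})=\lambda$ for all $n\ge1$ (i.e. jump size $1$). *)

(* Defs.v *)
From HB Require Import structures.
From mathcomp Require Import all_boot all_order all_algebra.
From mathcomp Require Import all_classical all_reals all_analysis.
From mathcomp Require Import complex.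

Set Implicit Arguments.
Unset Strict Implicit.
Unset Printing Implicit Defensive.

Import Order.TTheory GRing.Theory Num.Theory.
Import numFieldNormedType.Exports.

Local Open Scope classical_set_scope.
Local Open Scope ring_scope.

Record ncProbSpace (R : realType) := NcProbSpace {
  nc_alg :> algType R[i];
  nc_state : {scalar nc_alg};
  nc_state1 : nc_state 1 = 1
}.

Definition pair_fun (T : Type) (a b : T) (i : bool) : T := if i then b else a.

(* A non-commutative polynomial in the variables indexed by I, as a finite sum
   of coefficients times words. *)
Definition ncpoly (C I : Type) := seq (C * seq I).

(* The scalars enter S through iota, because square matrices of arbitrary size
   form a pzRingType but not a (non-trivial) algType: iota is scalar_mx on
   matrices and in_alg on algebras. *)
Definition ncpoly_eval (C I : Type) (S : pzRingType) (iota : C -> S)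
    (x : I -> S) (Q : ncpoly C I) : S :=
  \sum_(cw <- Q) iota cw.1 * \prod_(i <- cw.2) x i.

Definition gen_subalgebra (C : pzRingType) (A : lalgType C) (a : A) : set A :=
  smallest (fun S : set A => GRing.subalg_closed [pred x | x \in S]) [set a].

Definition free_subalgebras (R : realType) (A : ncProbSpace R) (I : Type)
    (S : I -> set A) : Prop :=
  forall (k : nat) (i : 'I_k -> I) (a : 'I_k -> A), (0 < k)%N ->
    (forall j, S (i j) (a j)) ->
    (forall j, nc_state A (a j) = 0) ->
    (forall j j' : 'I_k, j' = j.+1 :> nat -> i j <> i j') ->
    nc_state A (\prod_(j < k) a j) = 0.

Definition free_elements (R : realType) (A : ncProbSpace R) (I : Type)
    (x : I -> A) : Prop :=
  free_subalgebras (fun i => gen_subalgebra (x i)).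

Definition noncrossing n (pi : {set {set 'I_n}}) : bool :=
  [forall V in pi, forall W in pi, (V != W) ==>
    [forall i in V, forall k in V, forall j in W, forall l in W,
      ~~ [&& (i < j)%N, (j < k)%N & (k < l)%N]]].

Definition NC n (pi : {set {set 'I_n}}) : bool :=
  finset.partition pi [set: 'I_n]%SET && noncrossing pi.

Definition multilinear_form (C : pzRingType) (A : lmodType C) n
    (f : ('I_n -> A) -> C) : Prop :=
  forall (a : 'I_n -> A) (i : 'I_n) (c : C) (x y : A),
    f [eta a with i |-> c *: x + y] =
      c * f [eta a with i |-> x] + f [eta a with i |-> y].

(* enum_val lists the elements of a block in increasing order. *)
Definition is_free_cumulants (R : realType) (A : ncProbSpace R)
    (kappa : forall n, ('I_n -> A) -> R[i]) : Prop :=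
  (forall n, multilinear_form (@kappa n)) /\
  (forall n (a : 'I_n -> A), (0 < n)%N ->
    nc_state A (\prod_(i < n) a i) =
      \sum_(pi : {set {set 'I_n}} | NC pi) \prod_(V in pi)
        kappa #|V| (fun k : 'I_#|V| => a (enum_val k))).

Definition free_poisson (R : realType) (A : ncProbSpace R) (lambda : R)
    (x : A) : Prop :=
  0 < lambda /\
  exists kappa : forall n, ('I_n -> A) -> R[i],
    is_free_cumulants kappa /\
    forall n, (0 < n)%N -> kappa n (fun=> x) = lambda%:C%C.

Section Random.
Context d (T : measurableType d) (R : realType) (P : probability T R).

Definition independent_family d' (T' : measurableType d') (I : finType)
    (Y : I -> T -> T') : Prop :=
  forall (J : {set I}) (E : I -> set T'), (forall i, measurable (E i)) ->
    P (\bigcap_(i in [set` J]) (Y i @^-1` E i)) =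
      (\prod_(i in J) P (Y i @^-1` E i))%E.

Definition identically_distributed d' (T' : measurableType d') (I : Type)
    (Y : I -> T -> T') : Prop :=
  forall (i j : I) (E : set T'), measurable E ->
    P (Y i @^-1` E) = P (Y j @^-1` E).

(* Variance 0 is treated apart because normal_prob mu 0 is not the Dirac mass
   at mu. *)
Definition gaussian_law (mu v : R) : set R -> \bar R :=
  if v == 0 then \d_mu else normal_prob mu (Num.sqrt v).

Definition gaussian_vector m (Y : T -> m.-tuple R) : Prop :=
  measurable_fun setT Y /\
  forall t : 'I_m -> R, exists mu v : R, 0 <= v /\
    forall E : set R, measurable E ->
      P ((fun w => \sum_(j < m) t j * tnth (Y w) j) @^-1` E) =
        gaussian_law mu v E.

Definition has_mean m (Y : T -> m.-tuple R) (mu : 'rV[R]_m) : Prop :=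
  forall j, ('E_P[fun w => tnth (Y w) j] = (mu 0 j)%:E)%E.

Definition has_covariance m (Y : T -> m.-tuple R) (Sigma : 'M[R]_m) : Prop :=
  forall j k, covariance P (fun w => tnth (Y w) j) (fun w => tnth (Y w) k) =
    (Sigma j k)%:E.

Definition row_vector n m (X : T -> 'M[R]_(n, m)) (i : 'I_n) : T -> m.-tuple R :=
  fun w => [tuple X w i j | j < m].

Definition iid_standard_gaussian_rows n m (X : T -> 'M[R]_(n, m)) : Prop :=
  [/\ independent_family (row_vector X),
      identically_distributed (row_vector X) &
      forall i, [/\ gaussian_vector (row_vector X i),
                    has_mean (row_vector X i) 0 &
                    has_covariance (row_vector X i) 1%:M]].

Definition cexpectation (Z : T -> R[i]) : R[i] :=
  (fine 'E_P[fun w => complex.Re (Z w)] +i*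
   fine 'E_P[fun w => complex.Im (Z w)])%C.

Definition mx_state m (A : T -> 'M[R[i]]_m) : R[i] :=
  cexpectation (fun w => m%:R^-1 * \tr (A w)).

End Random.

Definition complex_mx (R : realType) n m (M : 'M[R]_(n, m)) : 'M[R[i]]_(n, m) :=
  map_mx (real_complex R) M.

Definition converges_jointly (R : realType) (d : nat -> measure_display)
    (T : forall n, measurableType (d n)) (P : forall n, probability (T n) R)
    (m : nat -> nat) (A B : forall n, T n -> 'M[R]_(m n))
    (S : ncProbSpace R) (a b : S) : Prop :=
  forall Q : ncpoly R[i] bool,
    mx_state (P n) (fun w => ncpoly_eval (@scalar_mx R[i] (m n))
        (pair_fun (complex_mx (A n w)) (complex_mx (B n w))) Q)
      @[n --> \oo] -->
    (nc_state S (ncpoly_eval (in_alg S) (pair_fun a b) Q) : R[i]^o).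

(* Main.v *)
Require Import Defs.
From HB Require Import structures.
From mathcomp Require Import all_boot all_order all_algebra.
From mathcomp Require Import all_classical all_reals all_analysis.
From mathcomp Require Import measurable_realfun complex.
From mathcomp Require Import ring lra zify.
From mathcomp.multinomials Require Import -(notations) monalg.

Set Implicit Arguments.
Unset Strict Implicit.
Unset Printing Implicit Defensive.

Import Order.TTheory GRing.Theory Num.Theory.
Import numFieldNormedType.Exports.

Local Open Scope classical_set_scope.
Local Open Scope ring_scope.
Import HBNNSimple.

(** Write W_0 and W_1 for the two matrices, that is W_i = n^-1 X^T D_i X with
    D_0 = B and D_1 = 1 - B, and tr for the normalised trace of size m. The
    only properties of D_0 and D_1 that matter are that they are symmetric,
    that D_i D_j is D_i if i = j and 0 otherwise, and that the trace of D_i,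
    divided by n, tends to q_i (q_0 = p and q_1 = 1 - p; the trace of an
    idempotent is its rank).

    Loop equations. The entries of X are independent standard Gaussian
    variables, so Gaussian integration by parts (polyd_stein) replaces, in the
    mean of a product of traces of words, one factor X_ab by the derivative in
    X_ab of all that remains. Applied to the first letter i of a word iV, and
    summed over (a, b), this expresses the mean of tr(iV) tr(w_1) ... tr(w_r)
    by means of products of traces with one letter less (loop_divergence,
    mean_ntrs_loop). The derivative of the partner of the chosen X gives
    tr(D_i)/n tr(V); a letter j of V = V'jV'' contributes only if i = j, because
    D_i D_j = 0 otherwise, and then gives m/n tr(V'i) tr(V''); all other terms
    carry a factor 1/n or 1/(nm). Since m/n tends to 1, induction on the number
    of letters (mean_ntrs_cvg) shows that the mean of the product tends to
    the product of the numbers tau(w) given by tau() = 1 and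
      tau(iV) = q_i tau(V) + sum over V = V'iV'' of tau(V'i) tau(V'').

    Limit space. The free algebra on two letters with the linear form tau is
    a non-commutative probability space, and the two letters x_0 and x_1 are
    the limits of W_0 and W_1. It remains to recognise their joint law.

    Freeness. Let phi be the linear form with value tau(w) at the word w. The
    recursion for tau says that phi(x_i g) = q_i phi(g) + (phi ⊗ phi)(d_i g),
    where d_i is the derivation from the algebra to its tensor square that
    sends x_i to x_i ⊗ 1 and the other letter to 0 (schwinger_dyson). For an alternating product of centred polynomials one
    strips a letter x_i off its first factor: every term of the resulting
    expression contains, after centring, an alternating product that is
    shorter or whose first factor has smaller degree. Hence the product has
    phi = 0 (centered_alternating_vanishes).

    Poisson law. Free cumulants exist in every space, because the
    moment-cumulant relation can be solved for the term of the one-block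
    partition (moment_cumulant). That all cumulants of x_i equal q_i means that
    tau(i^n) is the sum of q_i^(number of blocks) over the non-crossing
    partitions of n points. Decomposing a partition according to the successor
    of the first point in its block (glue_ncpart, cut_ncpart) shows that this
    sum satisfies the recursion which defines tau on powers (nc_sum_moments). *)

(** * Integrals against a weighted image measure *)

(** The hypothesis on nu says that it is the image under Y of the measure of
    density G with respect to mu. With G = 1 this is the law of a random
    variable, with Y = id a law with a density, and with G a product of
    independent factors it is the key to the factorisation of means. *)
Lemma ge0_integral_density d (T : measurableType d) d' (T' : measurableType d')
    (R : realType) (mu : {measure set T -> \bar R})
    (nu : {measure set T' -> \bar R}) (Y : T -> T') (G : T -> R) (f : T' -> R) :
  measurable_fun setT Y -> measurable_fun setT G -> (forall w, 0 <= G w) ->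
  (forall E, measurable E -> nu E = (\int[mu]_(w in Y @^-1` E) (G w)%:E)%E) ->
  measurable_fun setT f -> (forall x, 0 <= f x) ->
  (\int[nu]_x (f x)%:E = \int[mu]_w (f (Y w) * G w)%:E)%E.
Proof.
move=> mY mG G0 nuE mf f0.
have mF : measurable_fun setT (EFin \o f : T' -> \bar R) by exact/measurable_EFinP.
pose h := nnsfun_approx measurableT mF.
have hcvg x : (EFin \o (fun n => h n x)) n @[n --> \oo] --> (EFin \o f) x.
  by apply: cvg_nnsfun_approx => // y _; rewrite lee_fin.
have mhY n : measurable_fun setT (fun w => h n (Y w)).
  exact: (measurableT_comp (f := h n)).
have -> : (\int[nu]_x (f x)%:E =
    lim (\int[nu]_x (EFin \o h n) x @[n --> \oo]))%E.
  have fE x : (f x)%:E = lim ((EFin \o h n) x @[n --> \oo]).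
    by apply/esym/cvg_lim => //; exact: hcvg.
  under eq_integral do rewrite fE.
  apply: monotone_convergence => //.
  - by move=> n; apply/measurable_EFinP.
  - by move=> n x Ex //=; rewrite lee_fin.
  - by move=> x Ex a b ab; rewrite lee_fin; exact/lefP/nd_nnsfun_approx.
have -> : (\int[mu]_w (f (Y w) * G w)%:E =
    lim (\int[mu]_w ((EFin \o h n) (Y w) * (G w)%:E) @[n --> \oo]))%E.
  have fg w : (f (Y w) * G w)%:E = lim (((EFin \o h n) (Y w) * (G w)%:E)%E @[n --> \oo]).
    apply/esym/cvg_lim => //; rewrite EFinM; apply: cvgeZr => //; exact: hcvg.
  under eq_integral do rewrite fg.
  apply: monotone_convergence => [//| | |].
  - move=> n; apply: emeasurable_funM; exact/measurable_EFinP.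
  - by move=> n x Ex /=; rewrite mule_ge0 ?lee_fin.
  - by move=> x Ex a b ab/=; rewrite lee_wpmul2r ?lee_fin//; exact/lefP/nd_nnsfun_approx.
(* Monotone convergence on both sides leaves simple functions, and by
   linearity indicators, for which the identity is the hypothesis. *)
suff suf n : (\int[nu]_x (EFin \o h n) x =
    \int[mu]_w ((EFin \o h n) (Y w) * (G w)%:E))%E.
  by under eq_fun do rewrite suf.
transitivity (\int[nu]_x
   (\sum_(y \in range (h n)) (y * \1_(h n @^-1` [set y]) x)%:E))%E.
  by apply: eq_integral => t tE; rewrite /= {1}fimfunE -fsumEFin.
have mh r : measurable (h n @^-1` [set r]) by [].
have indich r : measurable_fun setT (fun x => (r * \1_(h n @^-1` [set r]) x)%:E).
  by apply: (measurable_comp measurableT) => //; exact: measurable_funM.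
rewrite ge0_integral_fsum//; last by move=> m y Ey; exact: nnfun_muleindic_ge0.
transitivity (\int[mu]_w (\sum_(y \in range (h n))
    (y * \1_(h n @^-1` [set y]) (Y w))%:E * (G w)%:E))%E; last first.
  apply: eq_integral => w _.
  rewrite -ge0_mule_fsuml => [|y]; last exact: nnfun_muleindic_ge0.
  by rewrite fsumEFin //= -(fimfunE _ (Y w)).
rewrite ge0_integral_fsum//; last 2 first.
  - move=> y; apply: emeasurable_funM; last exact/measurable_EFinP.
    exact: (measurableT_comp (indich y)).
  - by move=> m y Ey; apply: mule_ge0; [exact: nnfun_muleindic_ge0|rewrite lee_fin].
apply: eq_fsbigr => r rhn.
have r0 : 0 <= r by move: rhn; rewrite inE => -[t _ <-].
have mind : measurable_fun setT (fun w => \1_(h n @^-1` [set r]) (Y w) : R).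
  have mi : measurable_fun setT (\1_(h n @^-1` [set r]) : T' -> R) by [].
  exact: (measurableT_comp mi).
under eq_integral do rewrite EFinM.
rewrite ge0_integralZl//; last first.
  by apply/measurable_EFinP.
rewrite integral_indic// setIT nuE//.
under [RHS]eq_integral do rewrite EFinM -muleA.
rewrite ge0_integralZl//; last 2 first.
- by apply: emeasurable_funM; apply/measurable_EFinP.
- by move=> t _; rewrite mule_ge0 ?lee_fin.
congr (_ * _)%E.
rewrite integral_mkcond; apply: eq_integral => w _.
rewrite patchE indicE.
have -> : (w \in Y @^-1` (h n @^-1` [set r])) = (Y w \in h n @^-1` [set r]).
  by apply/idP/idP; rewrite !inE.
by case: ifP; rewrite ?mul1e ?mul0e.
Qed.

Section density.
Context d (T : measurableType d) d' (T' : measurableType d') (R : realType).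
Variables (mu : {measure set T -> \bar R}) (nu : {measure set T' -> \bar R}).
Variables (Y : T -> T') (G : T -> R).
Hypothesis mY : measurable_fun setT Y.
Hypothesis mG : measurable_fun setT G.
Hypothesis G0 : forall w, 0 <= G w.
Hypothesis nuE : forall E, measurable E ->
  nu E = (\int[mu]_(w in Y @^-1` E) (G w)%:E)%E.

Lemma integrable_density (f : T' -> R) : measurable_fun setT f ->
  nu.-integrable setT (EFin \o f) <->
  mu.-integrable setT (fun w => (f (Y w) * G w)%:E).
Proof.
move=> mf.
have mfY : measurable_fun setT (fun w => (f (Y w) * G w)%:E).
  apply/measurable_EFinP; apply: measurable_funM => //.
  exact: measurableT_comp.
have mff : measurable_fun setT (EFin \o f : T' -> \bar R) by exact/measurable_EFinP.
have eqn : (\int[nu]_x `|(EFin \o f) x| = \int[mu]_w `|(f (Y w) * G w)%:E|)%E.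
  under eq_integral do rewrite /=.
  rewrite (ge0_integral_density mY mG G0 nuE (f := fun x => `|f x|)) //; last first.
    exact: measurableT_comp.
  by apply: eq_integral => w _; rewrite /= normrM (ger0_norm (G0 w)).
by split => /integrableP[_ fi]; apply/integrableP; split => //;
  rewrite ?eqn// -eqn.
Qed.

(** Positive and negative parts are integrated separately, because the
    identity is first known for non-negative functions only. *)
Lemma Rintegral_density (f : T' -> R) : measurable_fun setT f ->
  mu.-integrable setT (fun w => (f (Y w) * G w)%:E) ->
  \int[nu]_x f x = \int[mu]_w (f (Y w) * G w).
Proof.
move=> mf fi.
have fi' : nu.-integrable setT (EFin \o f) by apply/integrable_density.
have ip : nu.-integrable setT (EFin \o (fun x => Num.max (f x) 0)).
  exact: (integrable_funrpos measurableT fi').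
have im : nu.-integrable setT (EFin \o (fun x => Num.max (- f x) 0)).
  exact: (integrable_funrneg measurableT fi').
have mp : measurable_fun setT (fun x => Num.max (f x) 0).
  by apply: measurable_maxr.
have mm : measurable_fun setT (fun x => Num.max (- f x) 0).
  by apply: measurable_maxr => //; apply: measurableT_comp.
have dec r : r = Num.max r 0 - Num.max (- r) 0 :> R.
  by case: (lerP 0 r) => r0; case: (lerP 0 (-r)) => r1; move: r0 r1; lra.
have ip' := (integrable_density mp).1 ip.
have im' := (integrable_density mm).1 im.
transitivity (\int[nu]_x (Num.max (f x) 0 - Num.max (- f x) 0)).
  by apply: eq_Rintegral => x _; exact: dec.
rewrite RintegralB//.
transitivity (\int[mu]_w (Num.max (f (Y w)) 0 * G w - Num.max (- f (Y w)) 0 * G w)); last first.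
  by apply: eq_Rintegral => w _; rewrite -mulrBl -dec.
rewrite RintegralB//.
rewrite /Rintegral.
rewrite (ge0_integral_density mY mG G0 nuE mp) ?(ge0_integral_density mY mG G0 nuE mm) //.
- by move=> x; rewrite le_max lexx orbT.
- by move=> x; rewrite le_max lexx orbT.
Qed.
End density.

(** * Integration by parts for the normal density *)
Section normal_moments.
Variable R : realType.
Implicit Types (m s x : R) (k n : nat).
Notation mu := (@lebesgue_measure R).

Lemma integrable_normal_fun m s : s != 0 ->
  mu.-integrable setT (EFin \o normal_fun m s).
Proof.
move=> s0.
have := integrable_normal_pdf m s.
move=> /(@integrableZl _ _ _ _ _ measurableT (normal_peak s)^-1).
apply: eq_integrable => // x _.
rewrite normal_pdfE//= -EFinM mulrA mulVf ?mul1r//.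
by rewrite gt_eqF// normal_peak_gt0.
Qed.

(** A power times a Gaussian is dominated by a wider Gaussian. The bound gives
    the integrability of all moments and, applied to one more power, the
    vanishing of the boundary terms at infinity. *)
Lemma normal_fun_bound m s k : s != 0 -> exists2 C : R, 0 <= C &
  forall x, `|(x - m) ^+ k| * normal_fun m s x <=
    C * normal_fun m (Num.sqrt 2 * s) x.
Proof.
move=> s0.
have even l : exists2 C : R, 0 <= C & forall x, (x - m) ^+ (2 * l) * normal_fun m s x <=
    C * normal_fun m (Num.sqrt 2 * s) x.
  exists ((4 * s ^+ 2) ^+ l * l`!%:R) => [|x].
    by rewrite mulr_ge0// exprn_ge0// mulr_ge0// sqr_ge0.
  rewrite /normal_fun [(Num.sqrt 2 * s) ^+ 2]exprMn sqr_sqrtr//.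
  (* Half of the exponent absorbs the power, since y ^ l <= l! exp y; the
     other half is the exponent of the normal density of variance 2 s ^ 2. *)
  set y := (x - m) ^+ 2 / (4 * s ^+ 2).
  have y0 : 0 <= y by rewrite divr_ge0 ?sqr_ge0// mulr_ge0// sqr_ge0.
  have -> : - (x - m) ^+ 2 / (s ^+ 2 *+ 2) = - y - y.
    by rewrite /y -[_ *+ 2]mulr_natr; field.
  have -> : - (x - m) ^+ 2 / (2 * s ^+ 2 *+ 2) = - y.
    by rewrite /y -[_ *+ 2]mulr_natr; field.
  rewrite expRD mulrA ler_wpM2r ?expR_ge0//.
  have -> : (x - m) ^+ (2 * l) = (4 * s ^+ 2) ^+ l * y ^+ l.
    by rewrite exprM -exprMn /y mulrC divfK// mulf_neq0// expf_neq0.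
  rewrite -mulrA ler_wpM2l//; first by rewrite exprn_ge0// mulr_ge0// sqr_ge0.
  rewrite expRN ler_pdivrMr ?expR_gt0//.
  case: l => [|l]; first by rewrite expr0 fact0 mul1r; apply: le_trans (expR_ge1Dx y); lra.
  have := expR_ge1Dxn l y0; rewrite -ler_pdivrMl ?ltr0n ?fact_gt0// mulrC.
  by apply: le_trans; rewrite lerDr.
have [C0 C00 H0] := even 0%N; have [C1 C10 H1] := even k.
(* Odd powers follow from t <= 1 + t ^ 2, where t is the power itself. *)
exists (C0 + C1) => [|x]; first exact: addr_ge0.
have := H0 x; have := H1 x; rewrite expr0 mul1r mulrDl => h1 h0.
apply: le_trans (lerD h0 h1).
rewrite mulnC exprM -[X in _ + X * _](real_normK (num_real _)).
have := sqr_ge0 (`|(x - m) ^+ k| - 1); have := normr_ge0 ((x - m) ^+ k).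
by have := normal_fun_ge0 m s x; nra.
Qed.

Lemma normal_fun_integrable m s k : s != 0 ->
  mu.-integrable setT (fun x => ((x - m) ^+ k * normal_fun m s x)%:E).
Proof.
move=> s0; have [C C0 HC] := normal_fun_bound m k s0.
apply: (@le_integrable _ _ R mu setT measurableT (fun x => ((x - m) ^+ k * normal_fun m s x)%:E)
    (fun x => (C%:E * (EFin \o normal_fun m (Num.sqrt 2 * s)) x)%E)).
- apply/measurable_EFinP; apply: measurable_funM; last exact: measurable_normal_fun.
  by apply: measurable_funX; apply: measurable_funB.
- move=> x _; rewrite /= lee_fin normrM (ger0_norm (normal_fun_ge0 _ _ _)).
  by apply: le_trans (HC x) _; rewrite ler_norm.
- apply: integrableZl => //; apply: integrable_normal_fun.
  by rewrite mulf_neq0// sqrtr_eq0 -ltNge.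
Qed.

Lemma integral_itv_cvg (f : R -> R) : mu.-integrable setT (EFin \o f) ->
  (\int[mu]_(x in `[(- n%:R)%R, n%:R%R]) (f x)%:E)%E @[n --> \oo] -->
  (\int[mu]_x (f x)%:E)%E.
Proof.
move=> fi.
under eq_fun do rewrite integral_mkcond.
have mf : measurable_fun setT (EFin \o f : R -> \bar R) by exact: measurable_int fi.
apply: (@dominated_cvg _ _ R mu setT measurableT
  (fun n => (fun x => (f x)%:E) \_ `[(- n%:R)%R, n%:R%R]) (fun x => (f x)%:E)
  (fun x => `|(f x)%:E|%E)) => //.
- by move=> n; apply/(measurable_restrictT _ _).1 => //; exact: measurable_funTS.
- move=> x _; apply: (@cvg_trans _ (cst (f x)%:E @ \oo)); last exact: cvg_cst.
  apply: near_eq_cvg; near=> n.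
  rewrite patchE ifT//= inE/= in_itv/= -ler_norml.
  by near: n; exact: nbhs_infty_ger.
- exact: (integrable_abse fi).
- by move=> n x _; rewrite patchE; case: ifP => _ //=; rewrite normr0 lee_fin.
Unshelve. all: by end_near. Qed.

Lemma is_derive_normal_fun m s k x : s != 0 ->
  is_derive x (1 : R) (fun x : R => (x - m) ^+ k * normal_fun m s x)
    ((k%:R * (x - m) ^+ k.-1 - (x - m) ^+ k.+1 / s ^+ 2) * normal_fun m s x).
Proof.
move=> s0.
have hu : is_derive x (1 : R) ((id : R -> R) - cst m) (1 - 0).
  exact: is_deriveB.
rewrite subr0 in hu.
have hX n : is_derive x (1 : R) (fun x : R => (x - m) ^+ n) (n%:R * (x - m) ^+ n.-1).
  rewrite (_ : (fun x : R => _) = ((id : R -> R) - cst m) ^+ n); last first.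
    by apply/funext => y; rewrite exprfctE.
  by apply: (is_derive_eq (is_deriveX n hu)); rewrite /GRing.scale/= mulr1.
have he : is_derive x (1 : R) (normal_fun m s) (- (x - m) / s ^+ 2 * normal_fun m s x).
  have hq : is_derive x (1 : R) (fun x : R => - (x - m) ^+ 2 / (s ^+ 2 *+ 2)) (- (x - m) / s ^+ 2).
    rewrite (_ : (fun x : R => _) = (- (s ^+ 2 *+ 2)^-1) \*: (fun x : R => (x - m) ^+ 2)); last first.
      apply/funext => y.
      by change (- (y - m) ^+ 2 / (s ^+ 2 *+ 2) = - (s ^+ 2 *+ 2)^-1 * (y - m) ^+ 2); ring.
    apply: (is_derive_eq (is_deriveZ _ (hX 2))).
    by rewrite /GRing.scale/= expr1 -[_ *+ 2]mulr_natr; field.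
  apply: (is_derive_eq (is_derive1_comp (is_derive_expR _) hq)).
  by rewrite /= mulrC.
apply: (is_derive_eq (is_deriveM (hX k) he)); rewrite /GRing.scale/=.
by rewrite [(x - m) ^+ k.+1]exprS; ring.
Qed.

Lemma normal_fun_cvg0 m s k (a : nat -> R) : s != 0 ->
  (forall n, n%:R <= `|a n|) ->
  (a n - m) ^+ k * normal_fun m s (a n) @[n --> \oo] --> 0.
Proof.
move=> s0 ha.
have [C C0 HC] := normal_fun_bound m k.+1 s0.
apply/cvgr0Pnorm_lt => e e0.
near=> n.
have na : `|m| + C / e + 1 <= `|a n|.
  apply: le_trans (ha n).
  near: n; exact: nbhs_infty_ger.
have nu : C / e < `|a n - m|.
  by have := ler_normD (a n - m) m; rewrite subrK; move: na; lra.
have Ce : 0 <= C / e by rewrite divr_ge0// ltW.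
have u0 : 0 < `|a n - m| by apply: le_lt_trans nu.
have := HC (a n).
rewrite normrM (ger0_norm (normal_fun_ge0 _ _ _)) exprSr normrM.
have N1 : normal_fun m (Num.sqrt 2 * s) (a n) <= 1.
  rewrite /normal_fun -expR0 ler_expR mulNr oppr_le0 divr_ge0 ?sqr_ge0//.
  by rewrite mulrn_wge0// sqr_ge0.
move=> h.
rewrite -(ltr_pM2r u0).
apply: (@le_lt_trans _ _ C).
  rewrite mulrAC; apply: le_trans h _.
  by rewrite ler_piMr.
by move: nu; rewrite ltr_pdivrMr// mulrC.
Unshelve. all: by end_near. Qed.

(** The derivative of (x - m) ^ k exp(- (x - m) ^ 2 / (2 s ^ 2)) has integral
    zero over the line: the fundamental theorem of calculus on [-n, n], whose
    boundary terms tend to 0. For k = 0 the factor k%:R makes the value of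
    k.-1 immaterial. *)
Lemma normal_fun_stein m s k : s != 0 ->
  \int[mu]_x ((x - m) ^+ k.+1 * normal_fun m s x) =
  s ^+ 2 * (k%:R * \int[mu]_x ((x - m) ^+ k.-1 * normal_fun m s x)).
Proof.
move=> s0.
pose f x := (k%:R * (x - m) ^+ k.-1 - (x - m) ^+ k.+1 / s ^+ 2) * normal_fun m s x.
pose F x := (x - m) ^+ k * normal_fun m s x.
have fE x : f x = k%:R * ((x - m) ^+ k.-1 * normal_fun m s x) -
                  (s ^+ 2)^-1 * ((x - m) ^+ k.+1 * normal_fun m s x).
  by rewrite /f; ring.
have i1 := normal_fun_integrable m k.-1 s0.
have i2 := normal_fun_integrable m k.+1 s0.
have i1' : mu.-integrable setT (fun x => (k%:R * ((x - m) ^+ k.-1 * normal_fun m s x))%:E).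
  by apply: (integrableZl _ _ i1).
have i2' : mu.-integrable setT (fun x => ((s ^+ 2)^-1 * ((x - m) ^+ k.+1 * normal_fun m s x))%:E).
  by apply: (integrableZl _ _ i2).
have fi : mu.-integrable setT (EFin \o f).
  have := integrableB measurableT i1' i2'.
  by apply: eq_integrable => // x _; rewrite /= fE EFinB.
suff f0 : \int[mu]_x f x = 0.
  have : \int[mu]_x f x = k%:R * \int[mu]_x ((x - m) ^+ k.-1 * normal_fun m s x) -
      (s ^+ 2)^-1 * \int[mu]_x ((x - m) ^+ k.+1 * normal_fun m s x).
    rewrite -!RintegralZl// -RintegralB//.
    by apply: eq_Rintegral => x _; rewrite fE.
  rewrite f0 => /esym/eqP; rewrite subr_eq0 => /eqP ->.
  by rewrite mulrA divff ?mul1r// expf_neq0.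
have cF k' : continuous (fun x : R => (x - m) ^+ k' * normal_fun m s x).
  move=> x; have [dF _] := is_derive_normal_fun m k' x s0.
  exact/differentiable_continuous/derivable1_diffP.
have cf : continuous f.
  move=> x; rewrite (_ : f = fun x => k%:R * ((x - m) ^+ k.-1 * normal_fun m s x) -
                  (s ^+ 2)^-1 * ((x - m) ^+ k.+1 * normal_fun m s x)); last exact/funext.
  by apply: cvgB; (apply: cvgM; [exact: cvg_cst|exact: cF]).
have lim0 : (\int[mu]_(x in `[(- n%:R)%R, n%:R%R]) (f x)%:E)%E @[n --> \oo] --> 0%E.
  have h : (F n%:R - F (- n%:R))%:E @[n --> \oo] --> (0 - 0)%:E.
    apply: cvg_EFin; first by near=> n.
    apply: cvgB; apply: normal_fun_cvg0 => // n; rewrite ?normrN ger0_norm//.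
  rewrite subr0 in h; apply: cvg_trans h; apply: near_eq_cvg; near=> n.
  have n0 : (0 < n)%N by near: n; exact: nbhs_infty_gt.
  rewrite (@continuous_FTC2 _ f F).
  - by rewrite EFinB.
  - by rewrite gtrN// ltr0n.
  - exact: continuous_subspaceT.
  - split.
    + by move=> x _; have [] := is_derive_normal_fun m k x s0.
    + exact/cvg_at_right_filter/cF.
    + exact/cvg_at_left_filter/cF.
  - by move=> x _; rewrite derive1E; have [_ ->] := is_derive_normal_fun m k x s0.
by rewrite /Rintegral (cvg_unique _ (integral_itv_cvg fi) lim0).
Unshelve. all: by end_near. Qed.

End normal_moments.

(** * Random variables with moments of all orders *)

(** The k-th moment of the centred normal law as a polynomial in its variance,
    (k - 1)!! v ^ (k / 2) for even k and 0 for odd k. Keeping the variance as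
    a variable lets one differentiate with respect to it. *)
Fixpoint gauss_mom (R : realType) k : {poly R} :=
  match k with
  | 0 => 1
  | 1 => 0
  | k'.+2 => k'.+1%:R *: ('X * gauss_mom R k')
  end.

Section all_moments.
Context d (T : measurableType d) (R : realType) (P : probability T R).
Implicit Types f g : T -> R.

Definition all_moments f := measurable_fun setT f /\
  forall k, P.-integrable setT (fun w => (f w ^+ k)%:E).

Lemma all_moments_integrable f : all_moments f -> P.-integrable setT (EFin \o f).
Proof. by move=> [_ /(_ 1%N)]. Qed.

Lemma all_moments_measurable f : all_moments f -> measurable_fun setT f.
Proof. by case. Qed.

(** |u v| <= u ^ 2 + v ^ 2 for u = f ^ i and v = g ^ j. *)
Lemma all_moments_mulXX f g i j : all_moments f -> all_moments g ->
  P.-integrable setT (fun w => (f w ^+ i * g w ^+ j)%:E).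
Proof.
move=> [mf hf] [mg hg].
apply: (@le_integrable _ _ R P setT measurableT _
    (fun w => (f w ^+ (i * 2))%:E + (g w ^+ (j * 2))%:E)%E).
- by apply/measurable_EFinP; apply: measurable_funM; exact: measurable_funX.
- move=> w _; rewrite /= lee_fin !exprM normrM.
  rewrite [leRHS]ger0_norm ?addr_ge0 ?sqr_ge0//.
  rewrite -[f w ^+ i ^+ 2](real_normK (num_real _)) -[g w ^+ j ^+ 2](real_normK (num_real _)).
  have := sqr_ge0 (`|f w ^+ i| - `|g w ^+ j|).
  by have := normr_ge0 (f w ^+ i); have := normr_ge0 (g w ^+ j); nra.
- by apply: integrableD.
Qed.

Lemma all_momentsM f g : all_moments f -> all_moments g ->
  all_moments (fun w => f w * g w).
Proof.
move=> hf hg; split; first by apply: measurable_funM; [case: hf|case: hg].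
move=> k; have := all_moments_mulXX k k hf hg.
by apply: eq_integrable => // w _; rewrite exprMn.
Qed.

Lemma all_momentsD f g : all_moments f -> all_moments g ->
  all_moments (fun w => f w + g w).
Proof.
move=> hf hg; split; first by apply: measurable_funD; [case: hf|case: hg].
move=> k.
have : P.-integrable setT (fun w => \sum_(i < k.+1)
    ('C(k, i)%:R%:E * (f w ^+ (k - i) * g w ^+ i)%:E)%E).
  apply: integrable_sum => // i _; apply: integrableZl => //.
  exact: all_moments_mulXX.
apply: eq_integrable => // w _; rewrite exprDn -sumEFin.
by apply: eq_bigr => i _; rewrite -EFinM mulr_natl.
Qed.

Lemma all_moments_cst c : all_moments (fun=> c).
Proof.
split=> // k; exact: (finite_measure_integrable_cst P (c ^+ k)).
Qed.

Lemma all_momentsZ c f : all_moments f -> all_moments (fun w => c * f w).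
Proof. by move=> hf; apply: all_momentsM => //; exact: all_moments_cst. Qed.

Lemma all_moments_sum (I : Type) (r : seq I) (Q : pred I) (F : I -> T -> R) :
  (forall i, all_moments (F i)) -> all_moments (fun w => \sum_(i <- r | Q i) F i w).
Proof.
move=> hF; elim: r => [|i r IH].
  by under eq_fun do rewrite big_nil; exact: all_moments_cst.
under eq_fun do rewrite big_cons.
by case: (Q i) => //; exact: all_momentsD.
Qed.

Lemma all_moments_prod (I : Type) (r : seq I) (Q : pred I) (F : I -> T -> R) :
  (forall i, Q i -> all_moments (F i)) -> all_moments (fun w => \prod_(i <- r | Q i) F i w).
Proof.
move=> hF; elim: r => [|i r IH].
  by under eq_fun do rewrite big_nil; exact: all_moments_cst.
under eq_fun do rewrite big_cons.
by case Qi : (Q i) => //; apply: all_momentsM => //; exact: hF.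
Qed.

Lemma all_momentsX f k : all_moments f -> all_moments (fun w => f w ^+ k).
Proof.
move=> hf; elim: k => [|k IH]; first exact: all_moments_cst.
by under eq_fun do rewrite exprS; exact: all_momentsM.
Qed.

Lemma all_moments_le f g : measurable_fun setT f -> (forall w, `|f w| <= `|g w|) ->
  all_moments g -> all_moments f.
Proof.
move=> mf fg [_ hg]; split => // k.
apply: (@le_integrable _ _ R P setT measurableT _ (fun w => (g w ^+ k)%:E)) => //.
  by apply/measurable_EFinP; exact: measurable_funX.
move=> w _; rewrite /= lee_fin !normrX; apply: lerXn2r; rewrite ?nnegrE//.
Qed.

Lemma meanD f g : all_moments f -> all_moments g ->
  \int[P]_w (f w + g w) = \int[P]_w f w + \int[P]_w g w.
Proof. by move=> hf hg; rewrite RintegralD//; exact: all_moments_integrable. Qed.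

Lemma meanZ c f : all_moments f -> \int[P]_w (c * f w) = c * \int[P]_w f w.
Proof. by move=> hf; rewrite RintegralZl//; exact: all_moments_integrable. Qed.

Lemma mean_cst c : \int[P]_w c = c.
Proof. by rewrite /Rintegral integral_cst//= probability_setT mule1. Qed.

Lemma mean_sum (I : Type) (r : seq I) (Q : pred I) (F : I -> T -> R) :
  (forall i, all_moments (F i)) ->
  \int[P]_w (\sum_(i <- r | Q i) F i w) = \sum_(i <- r | Q i) \int[P]_w F i w.
Proof.
move=> hF; elim: r => [|i r IH].
  by under eq_Rintegral do rewrite big_nil; rewrite big_nil mean_cst.
under eq_Rintegral do rewrite big_cons.
rewrite big_cons; case: (Q i) => //.
by rewrite meanD ?IH//; exact: all_moments_sum.
Qed.

(** The moments of the normal density obey the recursion that defines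
    gauss_mom, by integration by parts; only moments are used from here on,
    so that the degenerate and the non-degenerate laws need no separate
    treatment later. *)
Lemma gaussian_law_moment g m v : measurable_fun setT g -> 0 <= v ->
  (forall E, measurable E -> P (g @^-1` E) = gaussian_law m v E) ->
  forall k, P.-integrable setT (fun w => ((g w - m) ^+ k)%:E) /\
    \int[P]_w (g w - m) ^+ k = (gauss_mom R k).[v].
Proof.
move=> mg v0 hg k.
have mom0 j : 0 ^+ j = (gauss_mom R j).[0].
  case: j => [|[|j]]/=; first by rewrite expr0 hornerC.
    by rewrite expr1 horner0.
  by rewrite hornerZ hornerM hornerX mul0r mulr0 expr0n.
have mF : measurable_fun setT (fun x : R => (x - m) ^+ k).
  by apply: measurable_funX; exact: measurable_funB.
(* A degenerate law is a Dirac mass, for which only mom0 is needed. *)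
rewrite /gaussian_law in hg; case: ifPn hg => [/eqP ->|vn0] hg.
  pose nu : {measure set R -> \bar R} := dirac m.
  have nuE E : measurable E -> nu E = (\int[P]_(w in g @^-1` E) 1%:E)%E.
    move=> mE; transitivity (P (g @^-1` E)); first by rewrite hg.
    rewrite integral_cst ?mul1e//.
    by rewrite -[_ @^-1` _]setTI; exact: mg.
  have D1 := @integrable_density _ _ _ _ _ P nu g (cst 1) mg _ _ nuE _ mF.
  have D2 := @Rintegral_density _ _ _ _ _ P nu g (cst 1) mg _ _ nuE _ mF.
  have i1 : nu.-integrable setT (EFin \o (fun x : R => (x - m) ^+ k)).
    apply/integrableP; split; first exact/measurable_EFinP.
    have -> := @integral_dirac _ _ m R setT measurableT
      (fun x : R => `|((x - m) ^+ k)%:E|%E).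
      by rewrite diracT mul1e ltry.
    by apply/measurable_EFinP; apply: measurableT_comp.
  have i2 := (D1 (measurable_cst _) (fun=> ler01)).1 i1.
  have i3 : P.-integrable setT (fun w => ((g w - m) ^+ k)%:E).
    by move: i2; apply: eq_integrable => // w _; rewrite /= mulr1.
  split => //.
  have := D2 (measurable_cst _) (fun=> ler01) i2.
  under [X in _ = X]eq_Rintegral do rewrite /= mulr1.
  move=> <-; rewrite /Rintegral.
  have -> := @integral_dirac _ _ m R setT measurableT
    (fun x : R => ((x - m) ^+ k)%:E); last exact/measurable_EFinP.
  rewrite diracT mul1e.
  by rewrite /= subrr mom0.
pose s := Num.sqrt v.
have s0 : s != 0 by rewrite sqrtr_eq0 -ltNge lt_neqAle eq_sym vn0.
have s2 : s ^+ 2 = v by rewrite sqr_sqrtr.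
(* The density lemma is used twice: D1 and D2 carry integrals from the sample
   space to the law nu of g, N1 and N2 from nu to Lebesgue measure. *)
pose nu : {measure set (measurableTypeR R) -> \bar R} := normal_prob m s.
have nuE E : measurable E -> nu E = (\int[P]_(w in g @^-1` E) 1%:E)%E.
  move=> mE; transitivity (P (g @^-1` E)); first by rewrite hg.
  rewrite integral_cst ?mul1e//.
  by rewrite -[_ @^-1` _]setTI; exact: mg.
have D1 := @integrable_density _ _ _ _ _ P nu g (cst 1) mg _ _ nuE _ mF.
have D2 := @Rintegral_density _ _ _ _ _ P nu g (cst 1) mg _ _ nuE _ mF.
have N1 := @integrable_density _ _ _ _ _ lebesgue_measure nu id (normal_pdf m s) _
  (measurable_normal_pdf m s) (normal_pdf_ge0 m s) (fun _ _ => erefl) _ _.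
have N2 := @Rintegral_density _ _ _ _ _ lebesgue_measure nu id (normal_pdf m s) _
  (measurable_normal_pdf m s) (normal_pdf_ge0 m s) (fun _ _ => erefl) _ _.
have ij j : lebesgue_measure.-integrable setT (fun x => ((x - m) ^+ j * normal_pdf m s x)%:E).
  have := integrableZl measurableT (normal_peak s) (normal_fun_integrable m j s0).
  apply: eq_integrable => // x _.
  by rewrite normal_pdfE// -EFinM mulrCA.
have mF' j : measurable_fun setT (fun x : R => (x - m) ^+ j).
  by apply: measurable_funX; exact: measurable_funB.
have i1 : nu.-integrable setT (EFin \o (fun x : R => (x - m) ^+ k)).
  by apply/N1 => //; exact: ij.
have i2 := (D1 (measurable_cst _) (fun=> ler01)).1 i1.
have i3 : P.-integrable setT (fun w => ((g w - m) ^+ k)%:E).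
  by move: i2; apply: eq_integrable => // w _; rewrite /= mulr1.
split => //.
have := D2 (measurable_cst _) (fun=> ler01) i2.
under [X in _ = X]eq_Rintegral do rewrite /= mulr1.
move=> <-; rewrite N2//.
have JE j : \int[lebesgue_measure]_x ((x - m) ^+ j * normal_pdf m s x) =
    normal_peak s * \int[lebesgue_measure]_x ((x - m) ^+ j * normal_fun m s x).
  rewrite -RintegralZl//; last exact: normal_fun_integrable.
  by apply: eq_Rintegral => x _; rewrite normal_pdfE// mulrCA.
elim/ltn_ind: k {mF D1 D2 N1 N2 i1 i2 i3} => -[|[|k]] IH /=.
- under eq_Rintegral do rewrite expr0 mul1r.
  by rewrite /Rintegral integral_normal_pdf hornerC.
- by rewrite JE normal_fun_stein// mul0r !mulr0 horner0.
- rewrite hornerZ hornerM hornerX -IH// !JE normal_fun_stein// s2/=.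
  by ring.
Qed.

End all_moments.

(** * Means of products of independent variables *)
Section independence.
Context d (T : measurableType d) (R : realType) (P : probability T R).
Context d' (T' : measurableType d') (I : finType) (Y : I -> T -> T').
Hypothesis mY : forall i, measurable_fun setT (Y i).
Hypothesis indY : independent_family P Y.
Implicit Types f : I -> T' -> R.

Let upd f a (g : T' -> R) i := if i == a then g else f i.

Let prod_upd f a g w :
  \prod_i upd f a g i (Y i w) = g (Y a w) * \prod_(i | i != a) f i (Y i w).
Proof.
rewrite (bigD1 a)//= /upd eqxx; congr (_ * _).
by apply: eq_bigr => i /negbTE ->.
Qed.

Let prod_mean_upd f a g :
  \prod_i \int[P]_w upd f a g i (Y i w) =
  \int[P]_w g (Y a w) * \prod_(i | i != a) \int[P]_w f i (Y i w).
Proof.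
rewrite (bigD1 a)//= /upd eqxx; congr (_ * _).
by apply: eq_bigr => i /negbTE ->.
Qed.

Let factorizes f :=
  \int[P]_w \prod_i f i (Y i w) = \prod_i \int[P]_w f i (Y i w).

Let moments f := (forall i, measurable_fun setT (f i)) /\
  forall i, all_moments P (fun w => f i (Y i w)).

Let mean_indic (E : set T') i : measurable E ->
  \int[P]_w (\1_E (Y i w) : R) = fine (P (Y i @^-1` E)).
Proof.
move=> mE; rewrite /Rintegral; congr fine.
transitivity (\int[P]_w ((\1_(Y i @^-1` E) w)%:E))%E.
  by apply: eq_integral => w _; rewrite !indicE; congr (_%:R%:E); apply/idP/idP; rewrite !inE.
rewrite integral_indic ?setIT//.
by rewrite -[_ @^-1` _]setTI; exact: mY.
Qed.

Let factorizes_indic (E : I -> set T') : (forall i, measurable (E i)) ->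
  factorizes (fun i => \1_(E i)).
Proof.
move=> mE; rewrite /factorizes.
under eq_bigr do rewrite mean_indic//.
have mYE i : measurable (Y i @^-1` E i).
  by rewrite -[_ @^-1` _]setTI; exact: mY.
pose J := [set: I]%SET.
have mB : measurable (\bigcap_(i in [set` J]) (Y i @^-1` E i)).
  by apply: fin_bigcap_measurable.
transitivity (fine (P (\bigcap_(i in [set` J]) (Y i @^-1` E i)))).
  rewrite /Rintegral; congr fine.
  rewrite -[X in P X]setIT -integral_indic//; apply: eq_integral => w _.
  congr EFin; rewrite indicE.
  case: (boolP (w \in _)) => [|/negP] H.
    rewrite big1// => i _; rewrite indicE mem_set//.
    by move: H; rewrite inE => /(_ i); apply; rewrite /= inE.
  have [i Hi] : exists i, Y i w \notin E i.
    apply: contrapT => /forallNP H'; apply: H; rewrite inE => i _.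
    by apply: contrapT => Hi; apply: (H' i); apply/negP; rewrite inE.
  by rewrite (bigD1 i)//= indicE (negbTE Hi) mul0r.
rewrite (indY J mE).
have -> : (\prod_(i in J) P (Y i @^-1` E i) =
    (\prod_(i in J) fine (P (Y i @^-1` E i)))%R%:E)%E.
  elim/big_rec2: _ => [//|i y x _ ->].
  by rewrite EFinM fineK// fin_num_measure.
by rewrite /=; apply: eq_bigl => i; rewrite inE.
Qed.

(** Indicators of measurable sets factorise by definition of independence. The
    indices outside s carry indicators, and the induction on s exchanges the
    indicator at one more index a for an arbitrary non-negative function:
    the product of the other factors is used as a weight. *)
Let factorizes_ge0 (s : seq I) f : moments f -> (forall i x, 0 <= f i x) ->
  (forall i, i \notin s -> exists2 E, measurable E & f i = \1_E) -> factorizes f.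
Proof.
elim: s f => [|a s IH] f [mf hf] f0 fs.
  have /choice[E HE] : forall i, exists E, measurable E /\ f i = \1_E.
    by move=> i; have [//|E mE fE] := fs i; exists E.
  have -> : f = fun i => \1_(E i) by apply/funext => i; have [] := HE i.
  by apply: factorizes_indic => i; have [] := HE i.
pose G w := \prod_(i | i != a) f i (Y i w).
pose c := \prod_(i | i != a) \int[P]_w f i (Y i w).
have G0 w : 0 <= G w by apply: prodr_ge0 => i _.
have c0 : 0 <= c.
  by apply: prodr_ge0 => i _; apply: Rintegral_ge0.
have hG : all_moments P G by apply: all_moments_prod.
have hE E : measurable E -> (\int[P]_(w in Y a @^-1` E) (G w)%:E)%E = (c%:E * P (Y a @^-1` E))%E.
  move=> mE.
  have mYE : measurable (Y a @^-1` E) by rewrite -[_ @^-1` _]setTI; exact: mY.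
  have hu : moments (upd f a \1_E).
    split=> i; rewrite /upd; case: eqP => // ->.
    apply: (@all_moments_le _ _ _ P _ (cst 1)); last exact: all_moments_cst.
      have mi : measurable_fun setT (\1_E : T' -> R) by exact: measurable_indic.
      exact: (measurableT_comp mi).
    by move=> w; rewrite indicE; case: (_ \in _); rewrite ?normr0 ?normr1.
  have : factorizes (upd f a \1_E).
    apply: IH => //.
      by move=> i x; rewrite /upd; case: eqP => // _.
    move=> i; rewrite /upd; case: eqP => [_ _|/eqP ia si]; first by exists E.
    by apply: fs; rewrite inE negb_or ia.
  rewrite /factorizes prod_mean_upd mean_indic// -/c.
  under eq_Rintegral do rewrite prod_upd.
  rewrite -/(G _) => h.
  have i1 : P.-integrable setT (fun w => (\1_E (Y a w) * G w)%:E).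
    have : all_moments P (fun w => \1_E (Y a w) * G w).
      apply: all_momentsM => //; have := hu.2 a; rewrite /upd eqxx; apply.
    exact: all_moments_integrable.
  transitivity (\int[P]_w (\1_E (Y a w) * G w)%:E)%E.
    rewrite integral_mkcond; apply: eq_integral => w _; rewrite patchE indicE.
    have -> : (w \in Y a @^-1` E) = (Y a w \in E) by apply/idP/idP; rewrite !inE.
    by case: ifP; rewrite ?mul1r ?mul0r.
  rewrite -[LHS]fineK; last exact: integrable_fin_num i1.
  rewrite [fine _]h mulrC EFinM fineK// fin_num_measure//.
(* By hE, weighting P by G and pushing forward along Y a gives c times the law
   of Y a: the two are the measure nu below. *)
have main : (\int[P]_w (f a (Y a w) * G w)%:E = c%:E * \int[P]_w (f a (Y a w))%:E)%E.
  pose nu : {measure set T' -> \bar R} := mscale (NngNum c0) (pushforward P (Y a)).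
  rewrite -(@ge0_integral_density _ _ _ _ _ P (nu (mY a)) (Y a) G (f a))//.
  - rewrite ge0_integral_mscale//=.
    + rewrite ge0_integral_pushforward//=.
      * exact/measurable_EFinP.
      * by move=> x _; rewrite lee_fin.
    + exact/measurable_EFinP.
    + by move=> x _; rewrite lee_fin.
  - exact: all_moments_measurable hG.
  - by move=> E mE; rewrite hE.
have := hf a => /all_moments_integrable ha.
rewrite /factorizes.
under eq_Rintegral do rewrite (bigD1 a)//= -/(G _).
rewrite (bigD1 a)//= -/c {1}/Rintegral main fineM//=; last exact: integrable_fin_num ha.
by rewrite mulrC.
Qed.

(** Both sides are additive in each factor, so the non-negative case extends
    to signed functions by splitting one factor after another into positive
    and negative parts. *)
Lemma independent_mean_prod f : (forall i, measurable_fun setT (f i)) ->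
  (forall i, all_moments P (fun w => f i (Y i w))) ->
  \int[P]_w \prod_i f i (Y i w) = \prod_i \int[P]_w f i (Y i w).
Proof.
move=> mf hf; have : moments f by [].
have : forall i, i \notin enum I -> forall x, 0 <= f i x by move=> i; rewrite mem_enum.
move: {mf hf} (enum I) => s; elim: s f => [|a s IH] f f0 hf.
  apply: (@factorizes_ge0 (enum I)) => //; first by move=> i x; exact: f0.
  by move=> i; rewrite mem_enum.
pose fp x := Num.max (f a x) 0; pose fm x := Num.max (- f a x) 0.
have mp : measurable_fun setT fp by apply: measurable_maxr => //; exact: hf.1.
have mm : measurable_fun setT fm.
  by apply: measurable_maxr => //; apply: measurableT_comp => //; exact: hf.1.
have fE x : f a x = fp x - fm x.
  rewrite /fp /fm.
  by case: (lerP 0 (f a x)) => r0; case: (lerP 0 (- f a x)) => r1; move: r0 r1; lra.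
have le1 (r : R) : `|Num.max r 0| <= `|r|.
  by case: (lerP 0 r) => r0; rewrite ?normr0.
have hp : all_moments P (fun w => fp (Y a w)).
  apply: all_moments_le (hf.2 a); first exact: measurableT_comp.
  by move=> w; exact: le1.
have hm : all_moments P (fun w => fm (Y a w)).
  apply: all_moments_le (hf.2 a); first exact: measurableT_comp.
  by move=> w; rewrite -[leRHS]normrN; exact: le1.
have Hupd g : measurable_fun setT g -> all_moments P (fun w => g (Y a w)) ->
   (forall x, 0 <= g x) -> factorizes (upd f a g).
  move=> mg hg g0; apply: IH.
    move=> i si x; rewrite /upd; case: eqP => // /eqP ia.
    by apply: f0; rewrite inE negb_or ia.
  split => i; rewrite /upd; first by case: eqP => // _; exact: hf.1.
  by case: eqP => [->|_] //; exact: hf.2.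
have Hp := Hupd fp mp hp (fun x => ltac:(by rewrite le_max lexx orbT)).
have Hm := Hupd fm mm hm (fun x => ltac:(by rewrite le_max lexx orbT)).
have hG : all_moments P (fun w => \prod_(i | i != a) f i (Y i w)).
  by apply: all_moments_prod => i _; exact: hf.2.
transitivity (\int[P]_w (\prod_i upd f a fp i (Y i w) - \prod_i upd f a fm i (Y i w))).
  apply: eq_Rintegral => w _; rewrite !prod_upd -mulrBl -fE.
  by rewrite (bigD1 a).
rewrite RintegralB//.
- rewrite Hp Hm !prod_mean_upd -mulrBl -RintegralB//.
  + rewrite [RHS](bigD1 a)//=; congr (_ * _).
    by apply: eq_Rintegral => w _; rewrite -fE.
  + exact: all_moments_integrable hp.
  + exact: all_moments_integrable hm.
- apply: all_moments_integrable; under eq_fun do rewrite prod_upd; exact: all_momentsM.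
- apply: all_moments_integrable; under eq_fun do rewrite prod_upd; exact: all_momentsM.
Qed.

End independence.

(** * Polynomial functions with their formal derivatives *)
Section monomials.
Context (R : comNzRingType) (I : eqType).
Implicit Types (x : I -> R) (s : seq I).

Definition mon s x := \prod_(i <- s) x i.

Fixpoint dmon s b x : R :=
  if s is i :: s' then (i == b)%:R * mon s' x + x i * dmon s' b x else 0.

Lemma mon_cat s1 s2 x : mon (s1 ++ s2) x = mon s1 x * mon s2 x.
Proof. by rewrite /mon big_cat. Qed.

Lemma dmon_cat s1 s2 b x :
  dmon (s1 ++ s2) b x = dmon s1 b x * mon s2 x + mon s1 x * dmon s2 b x.
Proof.
elim: s1 => [|i s IH] /=; first by rewrite /mon big_nil mul0r add0r mul1r.
by rewrite IH mon_cat [mon (i :: s) x]big_cons -/(mon s x); ring.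
Qed.

(** F is a polynomial function and dF the family of its partial derivatives,
    computed from one and the same expression. Carrying the pair makes the
    calculus purely algebraic: no differentiability has to be proved. *)
Definition polyd (F : (I -> R) -> R) (dF : I -> (I -> R) -> R) :=
  exists L : seq (R * seq I),
    (forall x, F x = \sum_(cs <- L) cs.1 * mon cs.2 x) /\
    (forall b x, dF b x = \sum_(cs <- L) cs.1 * dmon cs.2 b x).

Lemma polyd_cst c : polyd (fun=> c) (fun _ _ => 0).
Proof.
by exists [:: (c, [::])]; split => *; rewrite big_seq1 /mon ?big_nil ?mulr1 ?mulr0.
Qed.

Lemma polyd_var i : polyd (fun x => x i) (fun b _ => (i == b)%:R).
Proof.
exists [:: (1, [:: i])]; split => *; rewrite big_seq1 mul1r ?/mon ?big_seq1//=.
by rewrite mulr0 addr0 /mon big_nil mulr1.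
Qed.

Lemma polydD F dF G dG : polyd F dF -> polyd G dG ->
  polyd (fun x => F x + G x) (fun b x => dF b x + dG b x).
Proof.
move=> [L1 [F1 D1]] [L2 [F2 D2]]; exists (L1 ++ L2).
by split=> *; rewrite big_cat /= ?F1 ?F2 ?D1 ?D2.
Qed.

Lemma polydM F dF G dG : polyd F dF -> polyd G dG ->
  polyd (fun x => F x * G x) (fun b x => dF b x * G x + F x * dG b x).
Proof.
move=> [L1 [F1 D1]] [L2 [F2 D2]].
exists [seq (cs.1 * dt.1, cs.2 ++ dt.2) | cs <- L1, dt <- L2]; split.
  move=> x; rewrite F1 F2 big_allpairs_dep mulr_suml; apply: eq_bigr => cs _.
  rewrite mulr_sumr; apply: eq_bigr => dt _ /=; rewrite mon_cat; ring.
move=> b x; rewrite F1 F2 D1 D2 big_allpairs_dep !mulr_suml -big_split.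
apply: eq_bigr => cs _ /=; rewrite !mulr_sumr -big_split; apply: eq_bigr => dt _ /=.
by rewrite dmon_cat; ring.
Qed.

Lemma polyd_ext F dF G dG : polyd F dF -> (forall x, G x = F x) ->
  (forall b x, dG b x = dF b x) -> polyd G dG.
Proof. by move=> [L [F1 D1]] FG DG; exists L; split=> *; rewrite ?FG ?DG. Qed.

Lemma polyd_sum (J : Type) (r : seq J) F dF : (forall j, polyd (F j) (dF j)) ->
  polyd (fun x => \sum_(j <- r) F j x) (fun b x => \sum_(j <- r) dF j b x).
Proof.
move=> h; elim: r => [|j r IH].
  by apply: polyd_ext (polyd_cst 0) _ _ => *; rewrite big_nil.
by apply: polyd_ext (polydD (h j) IH) _ _ => *; rewrite big_cons.
Qed.
End monomials.

Lemma poly_eq_horner (R : realType) (p q : {poly R}) :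
  (forall s, p.[s] = q.[s]) -> p = q.
Proof.
move=> pq; apply/eqP; rewrite -subr_eq0; apply/eqP.
pose rs : seq R := [seq i%:R | i <- iota 0 (size (p - q))].
apply: (@roots_geq_poly_eq0 _ _ rs).
- by apply/allP => x _; rewrite rootE !hornerE pq subrr.
- rewrite map_inj_uniq ?iota_uniq// => i j /eqP; rewrite eqr_nat => /eqP//.
- by rewrite size_map size_iota.
Qed.

(** The heat equation for the moments of the normal law of variance v,
    2 d/dv E(g ^ k) = E((d/dx) ^ 2 x ^ k at g). *)
Lemma deriv_gauss_mom (R : realType) k :
  2 *: (gauss_mom R k)^`() = (k * k.-1)%:R *: gauss_mom R k.-2.
Proof.
elim/ltn_ind: k => -[|[|k]] IH /=.
- by rewrite derivC scaler0 scale0r.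
- by rewrite deriv0 muln0 scaler0 scale0r.
rewrite derivZ derivM derivX mul1r scalerA [2 * _]mulrC -scalerA scalerDr.
have -> : 2 *: ('X * (gauss_mom R k)^`()) = k%:R *: gauss_mom R k.
  rewrite scalerAr IH//.
  case: k {IH} => [|[|k]] /=; rewrite ?muln0 ?scale0r ?mulr0 ?scaler0//.
  by rewrite -scalerAr !scalerA -natrM.
by rewrite -scalerDl scalerA -natrD -natrM mulnC.
Qed.

(** * Integration by parts for a Gaussian vector *)

(** The vector is known through its linear forms only: each of them is normal.
    Instead of deducing that the coordinates are independent, the moments of
    all linear forms are polarised, which gives Gaussian integration by parts
    directly. *)
Section gaussian_row.
Context d (T : measurableType d) (R : realType) (P : probability T R).
Context (m : nat) (Y : T -> m.-tuple R).
Hypothesis gY : gaussian_vector P Y.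
Hypothesis mean0 : has_mean P Y 0.
Hypothesis cov1 : has_covariance P Y 1%:M.

Let y w j := tnth (Y w) j.
Let lin (t : 'I_m -> R) w := \sum_(j < m) t j * y w j.

Lemma row_coord_all_moments j : all_moments P (fun w => y w j).
Proof.
have [_ h] := gY; have [mu [v [v0 hE]]] := h (fun i => (i == j)%:R).
have E w : \sum_(i < m) (i == j)%:R * tnth (Y w) i = y w j.
  rewrite (bigD1 j)//= eqxx mul1r big1 ?addr0// => i /negbTE ->.
  by rewrite mul0r.
have my : measurable_fun setT (fun w => y w j).
  by apply: (measurableT_comp (measurable_tnth j)); case: gY.
have mm : all_moments P (fun w => y w j - mu).
  split; first exact: measurable_funB.
  move=> k; have [] // := @gaussian_law_moment _ _ _ P (fun w => y w j) mu v my v0 _ k.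
  by move: hE; rewrite (funext E).
have := all_momentsD mm (all_moments_cst P mu).
by congr all_moments; apply/funext => w; rewrite subrK.
Qed.

Let hy := row_coord_all_moments.

Lemma row_coord_mean j : \int[P]_w y w j = 0.
Proof. by have := mean0 j; rewrite unlock mxE /Rintegral => ->. Qed.

Lemma row_coord_cov j k : \int[P]_w (y w j * y w k) = (j == k)%:R.
Proof.
have := cov1 j k; rewrite unlock unlock.
have e i : ('E_P[fun w => tnth (Y w) i] = 0%:E)%E by rewrite mean0 mxE.
rewrite unlock in e; rewrite !e mxE /Rintegral => h.
rewrite -[RHS]/(fine (j == k)%:R%:E) -h; congr fine; apply: eq_integral => w _.
change ((y w j * y w k)%:E = ((y w j - 0) * (y w k - 0))%:E).
by rewrite !subr0.
Qed.

Let hlin t : all_moments P (lin t).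
Proof. by apply: all_moments_sum => j; exact: all_momentsZ. Qed.

(** The mean and the covariance matrix identify the parameters of the normal
    law of the linear form: its variance is the sum of the squares of the
    coefficients. *)
Lemma row_lin_moment t k :
  \int[P]_w (lin t w) ^+ k = (gauss_mom R k).[\sum_j t j ^+ 2].
Proof.
have [_ /(_ t)[mu [v [v0 hE]]]] := gY.
have H := gaussian_law_moment (all_moments_measurable (hlin t)) v0 hE.
have ml : \int[P]_w lin t w = 0.
  rewrite mean_sum; last by move=> j; exact: all_momentsZ.
  by rewrite big1// => j _; rewrite meanZ// row_coord_mean mulr0.
have mu0 : mu = 0.
  have [_] := H 1%N; rewrite /= horner0.
  under eq_Rintegral do rewrite expr1.
  rewrite (meanD (hlin t) (all_moments_cst P (- mu))) mean_cst ml add0r => /eqP.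
  by rewrite oppr_eq0 => /eqP.
have H' l : \int[P]_w (lin t w) ^+ l = (gauss_mom R l).[v].
  by have [_ <-] := H l; apply: eq_Rintegral => w _; rewrite mu0 subr0.
rewrite H'; congr (_.[_]).
have := H' 2; rewrite /= scale1r mulr1 hornerX => <-.
transitivity (\int[P]_w \sum_j \sum_k (t j * t k) * (y w j * y w k)).
  apply: eq_Rintegral => w _; rewrite expr2 /lin mulr_suml; apply: eq_bigr => j _.
  by rewrite mulr_sumr; apply: eq_bigr => l _; ring.
rewrite mean_sum; last first.
  by move=> j; apply: all_moments_sum => l; apply: all_momentsZ; exact: all_momentsM.
apply: eq_bigr => j _; rewrite mean_sum; last first.
  by move=> l; apply: all_momentsZ; exact: all_momentsM.
rewrite (bigD1 j)//= big1 => [|l lj].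
  by rewrite addr0 meanZ ?row_coord_cov ?eqxx ?mulr1//; exact: all_momentsM.
by rewrite meanZ ?row_coord_cov 1?eq_sym ?(negbTE lj) ?mulr0//; exact: all_momentsM.
Qed.

Let shift (t : 'I_m -> R) b s j := t j + s * (j == b)%:R.

Let lin_shift t b s w : lin (shift t b s) w = lin t w + s * y w b.
Proof.
rewrite /lin /shift; under eq_bigr do rewrite mulrDl.
rewrite big_split/=; congr (_ + _); rewrite (bigD1 b)//= eqxx mulr1 big1 ?addr0//.
by move=> i /negbTE ->; rewrite mulr0 mul0r.
Qed.

(** The polynomial s |-> E(F (lin (t + s e_b)) ^ k), expanded in powers of s. *)
Let shift_poly F t b k : {poly R} :=
  \poly_(j < k.+1) ('C(k, j)%:R * \int[P]_w (F w * (y w b ^+ j * lin t w ^+ (k - j)))).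

Let horner_shift_poly F t b k s : all_moments P F ->
  (shift_poly F t b k).[s] = \int[P]_w (F w * lin (shift t b s) w ^+ k).
Proof.
move=> hF; rewrite horner_poly.
have hm (j : nat) : all_moments P (fun w => F w * (y w b ^+ j * lin t w ^+ (k - j))).
  by apply: all_momentsM => //; apply: all_momentsM; exact: all_momentsX.
transitivity (\int[P]_w \sum_(j < k.+1) ('C(k, j)%:R * s ^+ j) *
     (F w * (y w b ^+ j * lin t w ^+ (k - j)))).
  rewrite mean_sum; last by move=> j; exact: all_momentsZ.
  by apply: eq_bigr => j _; rewrite meanZ// mulrAC.
apply: eq_Rintegral => w _; rewrite lin_shift exprDn mulr_sumr; apply: eq_bigr => j _.
by rewrite exprMn -mulr_natl; ring.
Qed.

Let shift_poly0 F t b k : (shift_poly F t b k)`_0 = \int[P]_w (F w * lin t w ^+ k).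
Proof.
rewrite coef_poly bin0 mul1r; apply: eq_Rintegral => w _.
by rewrite expr0 mul1r subn0.
Qed.

Let shift_poly1 F t b k : (shift_poly F t b k)`_1 = k%:R * \int[P]_w (F w * (y w b * lin t w ^+ k.-1)).
Proof.
rewrite coef_poly bin1; case: k => [|k] /=; first by rewrite mul0r.
by congr (_ * _); apply: eq_Rintegral => w _; rewrite expr1 subSS subn0.
Qed.

(** The linear term in s of the moment of lin (t + s e_b), whose variance is
    |t| ^ 2 + 2 s t_b + s ^ 2; the heat equation turns the derivative in the
    variance back into a moment. *)
Let row_stein_lin t b k :
  \int[P]_w (y w b * lin t w ^+ k) = k%:R * t b * \int[P]_w (lin t w ^+ k.-1).
Proof.
pose v := \sum_j t j ^+ 2.
pose r : {poly R} := v%:P + (2 * t b) *: 'X + 'X^2.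
have vs s : \sum_j shift t b s j ^+ 2 = r.[s].
  rewrite !hornerE /shift -/v.
  under eq_bigr do rewrite sqrrD.
  rewrite !big_split/=; congr (_ + _ + _).
    rewrite (bigD1 b)//= eqxx big1 ?addr0; first by rewrite /= mulr1 mulr2n; ring.
    by move=> j /negbTE ->; rewrite /= !mulr0.
  rewrite (bigD1 b)//= eqxx big1 ?addr0; first by rewrite mulr1 expr2.
  by move=> j /negbTE ->; rewrite !mulr0 expr0n.
(* Two polynomials in s, both equal to the moment of order k.+1 of the linear
   form with coefficients t + s e_b; their linear coefficients are compared. *)
have e : shift_poly (cst 1) t b k.+1 = gauss_mom R k.+1 \Po r.
  apply: poly_eq_horner => s; rewrite horner_shift_poly; last exact: all_moments_cst.
  rewrite horner_comp -vs -row_lin_moment.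
  by apply: eq_Rintegral => w _; rewrite mul1r.
have : (shift_poly (cst 1) t b k.+1)`_1 = (gauss_mom R k.+1 \Po r)^`()`_0.
  by rewrite e coef_deriv.
rewrite shift_poly1 -horner_coef0 deriv_comp hornerM horner_comp.
have -> : r^`().[0] = 2 * t b.
  by rewrite /r !derivD derivC derivZ derivX derivXn !hornerE/= ?addr0 ?add0r.
have -> : r.[0] = v by rewrite !hornerE; ring.
rewrite mulrA [_ * 2]mulrC -hornerZ deriv_gauss_mom hornerZ -row_lin_moment/= natrM.
under eq_Rintegral do rewrite mul1r.
move=> h; apply: (@mulfI _ k.+1%:R); first by rewrite pnatr_eq0.
by rewrite h; ring.
Qed.

Let hmon s : all_moments P (fun w => mon s (y w)).
Proof. by apply: all_moments_prod. Qed.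

Let hdmon s b : all_moments P (fun w => dmon s b (y w)).
Proof.
elim: s => [|i s IH] /=; first exact: all_moments_cst.
by apply: all_momentsD; [exact: all_momentsZ|exact: all_momentsM].
Qed.

(** The power of a linear form is kept as a source of further coordinates:
    polarising it moves one factor y_c from the power to the monomial, so the
    induction needs the statement for all t and k. *)
Let row_stein_mon_lin s t b k :
  \int[P]_w (y w b * mon s (y w) * lin t w ^+ k) =
  \int[P]_w (dmon s b (y w) * lin t w ^+ k) +
  k%:R * t b * \int[P]_w (mon s (y w) * lin t w ^+ k.-1).
Proof.
elim: s t k => [|c s IH] t k.
  under eq_Rintegral do rewrite /mon big_nil mulr1.
  rewrite row_stein_lin /=.
  under [X in _ = X + _]eq_Rintegral do rewrite mul0r.
  rewrite mean_cst add0r; congr (_ * _); apply: eq_Rintegral => w _.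
  by rewrite /mon big_nil mul1r.
have hyM : all_moments P (fun w => y w b * mon s (y w)) by exact: all_momentsM.
(* The induction hypothesis at t + s e_c, for every s; its linear coefficient
   in s carries the extra factor y_c. *)
have e : shift_poly (fun w => y w b * mon s (y w)) t c k.+1 =
  shift_poly (fun w => dmon s b (y w)) t c k.+1 +
  (k.+1%:R *: ((t b)%:P + (b == c)%:R *: 'X)) * shift_poly (fun w => mon s (y w)) t c k.
  apply: poly_eq_horner => r.
  by rewrite !hornerE !horner_shift_poly// IH /= /shift [r * _]mulrC.
have : (shift_poly (fun w => y w b * mon s (y w)) t c k.+1)`_1 =
  (shift_poly (fun w => dmon s b (y w)) t c k.+1 +
  (k.+1%:R *: ((t b)%:P + (b == c)%:R *: 'X)) * shift_poly (fun w => mon s (y w)) t c k)`_1.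
  by rewrite e.
rewrite coefD shift_poly1 shift_poly1 coefM big_ord_recr big_ord1/= subn0 subnn shift_poly0 shift_poly1.
rewrite !coefZ !coefD !coefC !coefZ !coefX/= mulr0 addr0 add0r mulr1.
have k0 : k.+1%:R != 0 :> R by rewrite pnatr_eq0.
move=> h; apply: (mulfI k0); move: h.
under eq_Rintegral do rewrite -mulrA [mon s _ * _]mulrA.
rewrite [X in X = _](_ : _ = k.+1%:R * \int[P]_w (y w b * mon (c :: s) (y w) * lin t w ^+ k)); last first.
  congr (_ * _); apply: eq_Rintegral => w _; rewrite /mon big_cons; ring.
move=> ->.
transitivity (k.+1%:R * (\int[P]_w (dmon s b (y w) * (y w c * lin t w ^+ k)) +
   (b == c)%:R * \int[P]_w (mon s (y w) * lin t w ^+ k) +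
   k%:R * t b * \int[P]_w (mon s (y w) * (y w c * lin t w ^+ k.-1)))).
  ring.
congr (_ * (_ + _)).
  rewrite -meanZ; last by apply: all_momentsM => //; exact: all_momentsX.
  rewrite -meanD; last 2 first.
  - by apply: all_momentsM => //; apply: all_momentsM => //; exact: all_momentsX.
  - by apply: all_momentsZ; apply: all_momentsM => //; exact: all_momentsX.
  by apply: eq_Rintegral => w _; rewrite /= [c == b]eq_sym; ring.
congr (_ * _); apply: eq_Rintegral => w _; rewrite /mon big_cons; ring.
Qed.

Lemma row_stein s b :
  \int[P]_w (y w b * mon s (y w)) = \int[P]_w dmon s b (y w).
Proof.
have := row_stein_mon_lin s (fun=> 0) b 0; rewrite !mul0r addr0.
under eq_Rintegral do rewrite expr0 mulr1.
by under [X in _ = X -> _]eq_Rintegral do rewrite expr0 mulr1.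
Qed.

Lemma row_mon_all_moments s : all_moments P (fun w => mon s (y w)).
Proof. exact: hmon. Qed.

Lemma row_dmon_all_moments s b : all_moments P (fun w => dmon s b (y w)).
Proof. exact: hdmon. Qed.
End gaussian_row.

(** * Integration by parts for a matrix with independent Gaussian rows *)
Section gaussian_matrix.
Context d (T : measurableType d) (R : realType) (P : probability T R).
Context (n m : nat) (X : T -> 'M[R]_(n, m)).
Hypothesis hX : iid_standard_gaussian_rows P X.

Let entry w (ij : 'I_n * 'I_m) := X w ij.1 ij.2.
Let cols (i : 'I_n) (s : seq ('I_n * 'I_m)) := [seq x.2 | x <- s & x.1 == i].
Let Y := row_vector X.

Let entryE w i j : X w i j = tnth (Y i w) j.
Proof. by rewrite tnth_mktuple. Qed.

Let mon_rows s w : mon s (entry w) = \prod_i mon (cols i s) (tnth (Y i w)).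
Proof.
rewrite /mon (partition_big (fun x => x.1) predT)//=; apply: eq_bigr => i _.
rewrite big_map big_filter; apply: eq_bigr => x /eqP <-.
by rewrite /entry entryE.
Qed.

Let dmon_rows s a b w : dmon s (a, b) (entry w) =
  dmon (cols a s) b (tnth (Y a w)) * \prod_(i | i != a) mon (cols i s) (tnth (Y i w)).
Proof.
elim: s => [|[c e] s IH] /=; first by rewrite mul0r.
rewrite IH mon_rows /cols/=.
have [<-|ca] := eqVneq c a.
  rewrite /= /entry /= entryE (bigD1 c)//= mulrDl; congr (_ + _).
    rewrite -mulrA xpair_eqE eqxx/=; congr (_ * (_ * _)).
    by apply: eq_bigr => i; rewrite eq_sym => /negbTE ->.
  rewrite -mulrA; congr (_ * (_ * _)).
  by apply: eq_bigr => i; rewrite eq_sym => /negbTE ->.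
rewrite xpair_eqE (negbTE ca) mul0r add0r mulrCA; congr (_ * _).
rewrite (bigD1 c)//= [RHS](bigD1 c)//= eqxx /entry /= entryE mulrA; congr (_ * _).
  by rewrite {2}/mon big_cons.
by apply: eq_bigr => i /andP[_]; rewrite eq_sym => /negbTE ->.
Qed.

Let g i : gaussian_vector P (Y i). Proof. by case: hX => _ _ /(_ i) []. Qed.
Let mu0 i : has_mean P (Y i) 0. Proof. by case: hX => _ _ /(_ i) []. Qed.
Let cov i : has_covariance P (Y i) 1%:M. Proof. by case: hX => _ _ /(_ i) []. Qed.

Lemma entry_all_moments i j : all_moments P (fun w => X w i j).
Proof.
have := row_coord_all_moments (g i) j.
by congr all_moments; apply/funext => w; rewrite entryE.
Qed.

Let mon_all_moments s : all_moments P (fun w => mon s (entry w)).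
Proof. by apply: all_moments_prod => ij _; exact: entry_all_moments. Qed.

Let dmon_all_moments s b : all_moments P (fun w => dmon s b (entry w)).
Proof.
elim: s => [|i s IH] /=; first exact: all_moments_cst.
apply: all_momentsD; first exact: all_momentsZ.
by apply: all_momentsM => //; exact: entry_all_moments.
Qed.

Let mtnth j : measurable_fun setT (fun y : m.-tuple R => tnth y j).
Proof. exact: measurable_tnth. Qed.

Let mmon s : measurable_fun setT (fun y : m.-tuple R => mon s (tnth y)).
Proof. by apply: measurable_prod. Qed.

Let mdmon s b : measurable_fun setT (fun y : m.-tuple R => dmon s b (tnth y)).
Proof.
elim: s => [|i s IH] /=; first exact: measurable_cst.
apply: measurable_funD; apply: measurable_funM => //.
Qed.

(** A monomial in the entries is a product of monomials in the rows, so
    independence reduces the claim to the row a, the only one affected. *)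
Let mon_stein s a b :
  \int[P]_w (X w a b * mon s (entry w)) = \int[P]_w dmon s (a, b) (entry w).
Proof.
pose f i (y : m.-tuple R) :=
  (if i == a then tnth y b else 1) * mon (cols i s) (tnth y).
pose h i (y : m.-tuple R) :=
  if i == a then dmon (cols a s) b (tnth y) else mon (cols i s) (tnth y).
have mf i : measurable_fun setT (f i).
  by apply: measurable_funM => //; case: eqP.
have mh i : measurable_fun setT (h i) by rewrite /h; case: eqP.
have af i : all_moments P (fun w => f i (Y i w)).
  apply: all_momentsM; last exact: (row_mon_all_moments (g i)).
  case: eqP => _; last exact: all_moments_cst.
  exact: (row_coord_all_moments (g i)).
have ah i : all_moments P (fun w => h i (Y i w)).
  rewrite /h; case: eqP => [->|_].
    exact: (row_dmon_all_moments (g a)).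
  exact: (row_mon_all_moments (g i)).
have mY i : measurable_fun setT (Y i) by case: (g i).
have ind : independent_family P Y by case: hX.
transitivity (\int[P]_w \prod_i f i (Y i w)).
  apply: eq_Rintegral => w _; rewrite big_split /= -mon_rows; congr (_ * _).
  rewrite (bigD1 a)//= eqxx big1 ?mulr1 ?entryE// => i /negbTE -> //.
transitivity (\int[P]_w \prod_i h i (Y i w)); last first.
  apply: eq_Rintegral => w _; rewrite dmon_rows (bigD1 a)//= /h eqxx; congr (_ * _).
  by apply: eq_bigr => i /negbTE ->.
rewrite (independent_mean_prod mY ind mf af) (independent_mean_prod mY ind mh ah).
apply: eq_bigr => i _; rewrite /f /h; case: eqP => [->|_].
  exact: (row_stein (g a) (mu0 a) (cov a)).
by apply: eq_Rintegral => w _; rewrite mul1r.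
Qed.

Lemma polyd_all_moments F dF : polyd F dF -> all_moments P (fun w => F (entry w)).
Proof.
move=> [L [FE _]]; under eq_fun do rewrite FE.
by apply: all_moments_sum => cs; exact: all_momentsZ.
Qed.

Lemma polyd_diff_all_moments F dF b : polyd F dF ->
  all_moments P (fun w => dF b (entry w)).
Proof.
move=> [L [_ DE]]; under eq_fun do rewrite DE.
by apply: all_moments_sum => cs; exact: all_momentsZ.
Qed.

(** Gaussian integration by parts, E(X_ab F(X)) = E(dF/dX_ab (X)), for
    polynomials F in the entries. *)
Lemma polyd_stein F dF a b : polyd F dF ->
  \int[P]_w (X w a b * F (entry w)) = \int[P]_w dF (a, b) (entry w).
Proof.
move=> [L [FE DE]].
transitivity (\int[P]_w \sum_(cs <- L) cs.1 * (X w a b * mon cs.2 (entry w))).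
  by apply: eq_Rintegral => w _; rewrite FE mulr_sumr; apply: eq_bigr => cs _; ring.
have aXm s : all_moments P (fun w => X w a b * mon s (entry w)).
  by apply: all_momentsM => //; exact: entry_all_moments.
rewrite mean_sum; last by move=> cs; exact: all_momentsZ.
under [RHS]eq_Rintegral do rewrite DE.
rewrite mean_sum; last by move=> cs; exact: all_momentsZ.
by apply: eq_bigr => cs _; rewrite !meanZ ?mon_stein.
Qed.

End gaussian_matrix.

(** * Traces of words in the matrices n^-1 X^T D_i X *)

(** The pairs (w', w'') with w = w' i w''. *)
Fixpoint splits (I : eqType) (i : I) (w : seq I) : seq (seq I * seq I) :=
  if w is j :: w' then
    (if j == i then [:: ([::], w')] else [::]) ++
    [seq (j :: p.1, p.2) | p <- splits i w']
  else [::].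

(** All ways to single out one entry of the list, with the list of the
    others. *)
Fixpoint picks (U : Type) (ws : seq U) : seq (U * seq U) :=
  if ws is u :: ws' then
    (u, ws') :: [seq (p.1, u :: p.2) | p <- picks ws']
  else [::].

Section matrix_words.
Context (R : fieldType) (n m : nat) (D : bool -> 'M[R]_n).
Hypothesis Dsym : forall i, (D i)^T = D i.
Hypothesis Dorth : forall i j, D i *m D j = if i == j then D i else 0.
Implicit Types (X : 'M[R]_(n, m)) (w : seq bool) (b : 'I_n * 'I_m).

Definition wish X i : 'M[R]_m := n%:R^-1 *: (X^T *m D i *m X).

Fixpoint wmx X w : 'M[R]_m :=
  if w is i :: w' then wish X i *m wmx X w' else 1%:M.

(** The derivatives in X_b of wish X i, of the product wmx X w and, below, of
    the product ntrs X ws, given by the product rule. *)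
Definition dwish X b i : 'M[R]_m :=
  n%:R^-1 *: ((delta_mx b.1 b.2)^T *m D i *m X + X^T *m D i *m delta_mx b.1 b.2).

Fixpoint dwmx X b w : 'M[R]_m :=
  if w is i :: w' then dwish X b i *m wmx X w' + wish X i *m dwmx X b w' else 0.

Definition ntr X w : R := m%:R^-1 * \tr (wmx X w).

Definition ntrs X ws : R := \prod_(w <- ws) ntr X w.

Fixpoint dntrs X b ws : R :=
  if ws is w :: ws' then
    m%:R^-1 * \tr (dwmx X b w) * ntrs X ws' + ntr X w * dntrs X b ws'
  else 0.

Lemma wmx_cat X w1 w2 : wmx X (w1 ++ w2) = wmx X w1 *m wmx X w2.
Proof. by elim: w1 => [|i w IH] /=; rewrite ?mul1mx// IH mulmxA. Qed.

Lemma tr_wish X i : (wish X i)^T = wish X i.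
Proof. by rewrite /wish linearZ/= !trmx_mul trmxK Dsym mulmxA. Qed.

Lemma tr_wmx X w : (wmx X w)^T = wmx X (rev w).
Proof.
elim: w => [|i w IH] /=; first by rewrite trmx1.
by rewrite trmx_mul IH tr_wish rev_cons -cats1 wmx_cat /= mulmx1.
Qed.

Lemma mxtr_delta p q (i : 'I_p) (j : 'I_q) (Z : 'M[R]_(q, p)) :
  \tr (delta_mx i j *m Z) = Z j i.
Proof.
rewrite /mxtrace (bigD1 i)//= big1 => [|k ki].
  rewrite mxE (bigD1 j)//= big1 => [|l lj].
    by rewrite mxE !eqxx mul1r !addr0.
  by rewrite mxE (negbTE lj) andbF mul0r.
by rewrite mxE big1// => l _; rewrite mxE (negbTE ki) mul0r.
Qed.

Lemma mxtr_mul_delta p q r (A : 'M[R]_(r, p)) (i : 'I_p) (j : 'I_q)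
    (B : 'M[R]_(q, r)) : \tr (A *m delta_mx i j *m B) = (B *m A) j i.
Proof. by rewrite -mulmxA mxtrace_mulC -mulmxA mxtr_delta. Qed.

Lemma mulmx_delta_entry p q r s (A : 'M[R]_(r, p)) (i : 'I_p) (j : 'I_q)
    (B : 'M[R]_(q, s)) k l : (A *m delta_mx i j *m B) k l = A k i * B j l.
Proof.
rewrite -mulmxA mxE (bigD1 i)//= big1 => [|t ti].
  rewrite mxE (bigD1 j)//= big1 => [|t tj].
    by rewrite mxE !eqxx mul1r !addr0.
  by rewrite mxE (negbTE tj) andbF mul0r.
by rewrite mxE big1 ?mulr0// => u _; rewrite mxE (negbTE ti) mul0r.
Qed.

Lemma sum_entry_mul (A B : 'M[R]_(n, m)) :
  \sum_b A b.1 b.2 * B b.1 b.2 = \tr (A^T *m B).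
Proof.
rewrite /mxtrace -(pair_bigA _ (fun i j => A i j * B i j))/= exchange_big/=.
by apply: eq_bigr => j _; rewrite mxE; apply: eq_bigr => i _; rewrite mxE.
Qed.

Lemma sum_entry_diag (A : 'M[R]_n) (B : 'M[R]_m) :
  \sum_(b : 'I_n * 'I_m) A b.1 b.1 * B b.2 b.2 = \tr A * \tr B.
Proof.
rewrite -(pair_bigA _ (fun i j => A i i * B j j))/= /mxtrace mulr_suml.
by apply: eq_bigr => i _; rewrite mulr_sumr.
Qed.

Lemma wish_orth X i j : n%:R^-1 *: (X^T *m D i *m D j *m X) = if i == j then wish X i else 0.
Proof.
rewrite -(mulmxA X^T) Dorth; case: eqP => // _.
by rewrite mulmx0 mul0mx scaler0.
Qed.

(** The derivative in X_b replaces one of the two X in a letter j of w by an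
    elementary matrix. Summing over b contracts the two indices: if X^T is
    replaced, the part between the two marked X is transposed and stays in
    the same product; if X is replaced, the product is cut into two traces.
    In both cases D_i and D_j become neighbours, so only j = i survives. *)
Lemma sum_diff_word X i w (U N : 'M[R]_m) :
  \sum_b (D i *m X *m U *m dwmx X b w *m N) b.1 b.2 =
  \sum_(p <- splits i w)
     (\tr ((U *m wmx X p.1)^T *m wish X i *m wmx X p.2 *m N) +
      \tr (U *m wmx X p.1 *m wish X i) * \tr (wmx X p.2 *m N)).
Proof.
elim: w U => [|j w IH] U /=.
  by rewrite big_nil big1// => b _; rewrite mulmx0 mul0mx mxE.
rewrite big_cat big_map/=.
under eq_bigr do rewrite mulmxDr mulmxDl mxE.
rewrite big_split/=; congr (_ + _); last first.
  transitivity (\sum_b (D i *m X *m (U *m wish X j) *m dwmx X b w *m N) b.1 b.2).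
    by apply: eq_bigr => b _; rewrite !mulmxA.
  by rewrite IH; apply: eq_bigr => p _; rewrite !mulmxA.
set N' := wmx X w *m N.
transitivity (\sum_b ((n%:R^-1 *: (D i *m X *m U)) b.1 b.2 * (D j *m X *m N') b.1 b.2 +
    (n%:R^-1 *: (D i *m X *m U *m X^T *m D j)) b.1 b.1 * N' b.2 b.2)).
  apply: eq_bigr => -[a b] _ /=; rewrite /dwish/=.
  have -> : D i *m X *m U *m (n%:R^-1 *: ((delta_mx a b)^T *m D j *m X +
      X^T *m D j *m delta_mx a b) *m wmx X w) *m N =
    (n%:R^-1 *: (D i *m X *m U)) *m delta_mx b a *m (D j *m X *m N') +
    (n%:R^-1 *: (D i *m X *m U *m X^T *m D j)) *m delta_mx a b *m N'.
    rewrite trmx_delta -!scalemxAl -scalemxAr -!scalemxAl -scalerDr; congr (_ *: _).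
    by rewrite mulmxDl mulmxDr mulmxDl /N' !mulmxA.
  by rewrite mxE !mulmx_delta_entry.
rewrite big_split/= sum_entry_mul sum_entry_diag.
have -> : (n%:R^-1 *: (D i *m X *m U))^T *m (D j *m X *m N') =
    U^T *m (n%:R^-1 *: (X^T *m D i *m D j *m X)) *m N'.
  rewrite linearZ /= !trmx_mul Dsym -scalemxAr -!scalemxAl; congr (_ *: _).
  by rewrite !mulmxA.
have -> : \tr (n%:R^-1 *: (D i *m X *m U *m X^T *m D j)) =
    \tr (U *m (n%:R^-1 *: (X^T *m D j *m D i *m X))).
  rewrite -scalemxAr !linearZ /=; congr (_ * _).
  by rewrite -2!mulmxA mxtrace_mulC -!mulmxA.
rewrite !wish_orth [j == i]eq_sym.
case: eqP => [->|_]; last by rewrite big_nil !(mulmx0, mul0mx) !mxtrace0 mul0r addr0.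
by rewrite big_seq1 /= !mulmx1 ?mulmxA.
Qed.

(** The same contraction, with the derivative acting inside another trace: the
    two traces are always merged into one. *)
Lemma sum_diff_trace X i V w (K : 'M[R]_m) :
  \sum_b (D i *m X *m V) b.1 b.2 * \tr (K *m dwmx X b w) =
  \sum_(p <- splits i w)
     (\tr (V^T *m wish X i *m wmx X p.2 *m K *m wmx X p.1) +
      \tr (V *m wmx X p.2 *m K *m wmx X p.1 *m wish X i)).
Proof.
elim: w K => [|j w IH] K /=.
  by rewrite big_nil big1// => b _; rewrite mulmx0 mxtrace0 mulr0.
rewrite big_cat big_map/=.
under eq_bigr do rewrite mulmxDr linearD mulrDr /= !mulmxA.
rewrite big_split/=; congr (_ + _); last first.
  rewrite IH; apply: eq_bigr => p _; by rewrite !mulmxA.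
set N' := wmx X w.
transitivity (\sum_b ((n%:R^-1 *: (D i *m X *m V)) b.1 b.2 * (D j *m X *m N' *m K) b.1 b.2 +
    (n%:R^-1 *: (D i *m X *m V)) b.1 b.2 * ((N' *m K *m X^T *m D j)^T) b.1 b.2)).
  apply: eq_bigr => -[a b] _ /=; rewrite /dwish/=.
  rewrite [(_ *: (D i *m X *m V)) a b]mxE [(_^T) a b]mxE.
  have -> : K *m (n%:R^-1 *: ((delta_mx a b)^T *m D j *m X +
      X^T *m D j *m delta_mx a b)) *m N' =
    n%:R^-1 *: ((K *m delta_mx b a) *m (D j *m X *m N') + K *m X^T *m D j *m delta_mx a b *m N').
    rewrite trmx_delta -scalemxAr -!scalemxAl; congr (_ *: _).
    by rewrite mulmxDr mulmxDl !mulmxA.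
  by rewrite linearZ linearD /= !mxtr_mul_delta !mulmxA; ring.
rewrite big_split/= !sum_entry_mul.
have -> : (n%:R^-1 *: (D i *m X *m V))^T *m (D j *m X *m N' *m K) =
    V^T *m (n%:R^-1 *: (X^T *m D i *m D j *m X)) *m N' *m K.
  rewrite linearZ /= !trmx_mul Dsym -scalemxAr -!scalemxAl; congr (_ *: _).
  by rewrite !mulmxA.
have -> : \tr ((n%:R^-1 *: (D i *m X *m V))^T *m (N' *m K *m X^T *m D j)^T) =
    \tr (V *m N' *m K *m (n%:R^-1 *: (X^T *m D j *m D i *m X))).
  rewrite -trmx_mul mxtrace_tr -scalemxAr -scalemxAr !linearZ /=; congr (_ * _).
  by rewrite [LHS]mxtrace_mulC -!mulmxA mxtrace_mulC -!mulmxA mxtrace_mulC -!mulmxA.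
rewrite !wish_orth [j == i]eq_sym.
case: eqP => [->|_]; last by rewrite big_nil !(mulmx0, mul0mx) !mxtrace0 addr0.
by rewrite big_seq1 /= !mulmx1 ?mulmxA.
Qed.

Lemma dntrs_picks X b ws : dntrs X b ws =
  \sum_(z <- picks ws) m%:R^-1 * \tr (dwmx X b z.1) * ntrs X z.2.
Proof.
elim: ws => [|w ws IH] /=; first by rewrite big_nil.
rewrite big_cons big_map /= IH [ntr X w * _]mulr_sumr; congr (_ + _).
by apply: eq_bigr => z _ /=; rewrite /ntrs big_cons; ring.
Qed.

Lemma ntrs_cons X w ws : ntrs X (w :: ws) = ntr X w * ntrs X ws.
Proof. by rewrite /ntrs big_cons. Qed.

Lemma ntrs_nil X ws : (m%:R != 0 :> R) -> ntrs X ([::] :: ws) = ntrs X ws.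
Proof. by move=> m0; rewrite ntrs_cons /ntr /= mxtrace1 mulVf ?mul1r. Qed.

Lemma ntr_wish X i w : ntr X (i :: w) =
  m%:R^-1 * n%:R^-1 * \sum_b X b.1 b.2 * (D i *m X *m wmx X w) b.1 b.2.
Proof.
rewrite sum_entry_mul /ntr /= /wish -scalemxAl linearZ /= mulrA.
by rewrite !mulmxA.
Qed.

(** The expression that remains of the mean of ntrs X ((i :: V) :: ws) after
    integration by parts: first line, the derivative of the second X in the
    first letter; second and third, of the letters of V; last, of those of
    the other traces. In total there is one letter i less than at the start. *)
Definition loop_rhs X i V ws : R :=
  \tr (D i) / n%:R * ntrs X (V :: ws) +
  \sum_(p <- splits i V)
    (n%:R^-1 * ntrs X ((rev p.1 ++ i :: p.2) :: ws) +
     m%:R / n%:R * ntrs X (rcons p.1 i :: p.2 :: ws)) +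
  n%:R^-1 * m%:R^-1 * \sum_(z <- picks ws) \sum_(p <- splits i z.1)
    (ntrs X ((rev V ++ i :: p.2 ++ p.1) :: z.2) +
     ntrs X (rcons (V ++ p.2 ++ p.1) i :: z.2)).

(** The sum on the left is the divergence, with respect to the entries of X,
    of the field D_i X (wmx X V) times ntrs X ws. *)
Lemma loop_divergence X i V ws : m%:R != 0 :> R ->
  m%:R^-1 * n%:R^-1 * \sum_b
    ((D i *m delta_mx b.1 b.2 *m wmx X V + D i *m X *m dwmx X b V) b.1 b.2 * ntrs X ws +
     (D i *m X *m wmx X V) b.1 b.2 * dntrs X b ws) = loop_rhs X i V ws.
Proof.
move=> m0.
rewrite big_split/= -mulr_suml mulrDr; congr (_ + _).
  under eq_bigr do rewrite mxE mulmx_delta_entry.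
  rewrite big_split/= sum_entry_diag.
  have -> : \sum_b (D i *m X *m dwmx X b V) b.1 b.2 = \sum_(p <- splits i V)
     (\tr ((wmx X p.1)^T *m wish X i *m wmx X p.2) +
      \tr (wmx X p.1 *m wish X i) * \tr (wmx X p.2)).
    transitivity (\sum_b (D i *m X *m 1%:M *m dwmx X b V *m 1%:M) b.1 b.2).
      by apply: eq_bigr => b _; rewrite !mulmx1.
    by rewrite sum_diff_word; apply: eq_bigr => p _; rewrite !mul1mx !mulmx1.
  rewrite mulrDl mulrDr; congr (_ + _).
    by rewrite ntrs_cons /ntr; ring.
  rewrite mulr_suml mulr_sumr; apply: eq_bigr => p _.
  rewrite !ntrs_cons /ntr -cats1 !wmx_cat /= !mulmx1 ?mulmxA tr_wmx.
  by move: (n%:R^-1) => ni; field.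
have -> : \sum_b (D i *m X *m wmx X V) b.1 b.2 * dntrs X b ws =
  \sum_(z <- picks ws) m%:R^-1 * ntrs X z.2 *
    \sum_b (D i *m X *m wmx X V) b.1 b.2 * \tr (1%:M *m dwmx X b z.1).
  under eq_bigr do rewrite dntrs_picks mulr_sumr.
  rewrite exchange_big; apply: eq_bigr => z _ /=; rewrite mulr_sumr.
  by apply: eq_bigr => b _; rewrite mul1mx; ring.
rewrite [m%:R^-1 / _]mulrC; congr (_ * _).
rewrite (eq_bigr (fun z => \sum_(p <- splits i z.1)
    (ntrs X ((rev V ++ i :: p.2 ++ p.1) :: z.2) +
     ntrs X (rcons (V ++ p.2 ++ p.1) i :: z.2)))) // => z _.
rewrite sum_diff_trace !mulr_sumr; apply: eq_bigr => p _.
rewrite !ntrs_cons /ntr -cats1 !wmx_cat /= !wmx_cat !mulmx1 ?mulmxA tr_wmx.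
ring.
Qed.

End matrix_words.

Section matrix_polynomials.
Context (R : fieldType) (n m : nat).
Local Notation idx := ('I_n * 'I_m)%type.

(** Matrix-valued polynomials in the entries with their formal derivatives,
    entry by entry. *)
Definition polymx p q (A : (idx -> R) -> 'M[R]_(p, q))
    (dA : idx -> (idx -> R) -> 'M[R]_(p, q)) :=
  forall i j, polyd (fun x => A x i j) (fun b x => dA b x i j).

Lemma polymx_cst p q (M : 'M[R]_(p, q)) : polymx (fun=> M) (fun _ _ => 0).
Proof. by move=> i j; apply: polyd_ext (polyd_cst _ (M i j)) _ _ => // b x; rewrite mxE. Qed.

Lemma polymx_var : polymx (fun x => \matrix_(i < n, j < m) x (i, j))
  (fun b _ => delta_mx b.1 b.2).
Proof.
move=> i j; apply: polyd_ext (polyd_var _ (i, j)) _ _ => [x|[b1 b2] x]; rewrite mxE //=.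
Qed.

Lemma polymxM p q r (A : _ -> 'M[R]_(p, q)) (B : _ -> 'M[R]_(q, r)) dA dB :
  polymx A dA -> polymx B dB ->
  polymx (fun x => A x *m B x) (fun b x => dA b x *m B x + A x *m dB b x).
Proof.
move=> hA hB i j.
apply: polyd_ext (polyd_sum (index_enum _) (fun k => polydM (hA i k) (hB k j))) _ _ => *.
  by rewrite mxE.
by rewrite !mxE -big_split.
Qed.

Lemma polymxT p q (A : _ -> 'M[R]_(p, q)) dA : polymx A dA ->
  polymx (fun x => (A x)^T) (fun b x => (dA b x)^T).
Proof. by move=> hA i j; apply: polyd_ext (hA j i) _ _ => *; rewrite mxE. Qed.

Lemma polymxZ p q c (A : _ -> 'M[R]_(p, q)) dA : polymx A dA ->
  polymx (fun x => c *: A x) (fun b x => c *: dA b x).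
Proof.
move=> hA i j; apply: polyd_ext (polydM (polyd_cst _ c) (hA i j)) _ _ => *.
  by rewrite mxE.
by rewrite mxE mul0r add0r.
Qed.

Lemma polymx_ext p q (A : _ -> 'M[R]_(p, q)) dA dA' : polymx A dA ->
  (forall b x, dA' b x = dA b x) -> polymx A dA'.
Proof. by move=> hA h i j; apply: polyd_ext (hA i j) _ _ => // *; rewrite h. Qed.

Lemma polyd_mxtrace p (A : _ -> 'M[R]_p) dA : polymx A dA ->
  polyd (fun x => \tr (A x)) (fun b x => \tr (dA b x)).
Proof. by move=> hA; apply: polyd_ext (polyd_sum (index_enum _) (fun k => hA k k)) _ _. Qed.

Variable D : bool -> 'M[R]_n.
Let mxof (x : idx -> R) : 'M[R]_(n, m) := \matrix_(i < n, j < m) x (i, j).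

Lemma polymx_wmx w : polymx (fun x => wmx D (mxof x) w)
  (fun b x => dwmx D (mxof x) b w).
Proof.
elim: w => [|i w IH] /=; first exact: polymx_cst.
apply: polymxM => //; apply: polymxZ.
have h := polymxM (polymxM (polymxT polymx_var) (polymx_cst (D i))) polymx_var.
by apply: polymx_ext h _ => b x; rewrite mulmx0 addr0.
Qed.

Lemma polyd_ntrs ws : polyd (fun x => ntrs D (mxof x) ws)
  (fun b x => dntrs D (mxof x) b ws).
Proof.
elim: ws => [|w ws IH] /=.
  by apply: polyd_ext (polyd_cst _ 1) _ _ => // x; rewrite /ntrs big_nil.
have h := polydM (polyd_cst _ m%:R^-1) (polyd_mxtrace (polymx_wmx w)).
apply: polyd_ext (polydM h IH) _ _ => [x|b x] /=; first exact: ntrs_cons.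
by rewrite mul0r add0r.
Qed.

Lemma polymx_DXw i w : polymx (fun x => D i *m mxof x *m wmx D (mxof x) w)
  (fun b x => D i *m delta_mx b.1 b.2 *m wmx D (mxof x) w +
     D i *m mxof x *m dwmx D (mxof x) b w).
Proof.
have h := polymxM (polymxM (polymx_cst (D i)) polymx_var) (polymx_wmx w).
by apply: polymx_ext h _ => b x; rewrite mul0mx add0r.
Qed.
End matrix_polynomials.

(** * Convergence of the mean traces *)

(** In particular a split removes exactly one letter. *)
Lemma splits_cat (I : eqType) (i : I) w p : p \in splits i w -> w = p.1 ++ i :: p.2.
Proof.
elim: w p => [//|j w IH] p /=; rewrite mem_cat => /orP[|/mapP[q qs ->]].
  by case: eqP => // ->; rewrite inE => /eqP ->.
by rewrite /= -IH.
Qed.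

Definition letters (I : Type) (ws : seq (seq I)) := sumn (map size ws).

Lemma picks_letters (I : eqType) (ws : seq (seq I)) z : z \in picks ws ->
  (size z.1 + letters z.2)%N = letters ws.
Proof.
elim: ws z => [//|w ws IH] z /=; rewrite inE => /orP[/eqP ->//|/mapP[y /IH e ->]].
by rewrite /letters /= -/(letters ws) -e addnCA.
Qed.

(** The recursion calls words that are not subterms of i :: w', so it descends
    on a bound k of the length. *)
Fixpoint limit_moment_rec (R : pzSemiRingType) (q : bool -> R) k (w : seq bool) : R :=
  match w, k with
  | [::], _ => 1
  | _ :: _, 0 => 0
  | i :: w', k'.+1 => q i * limit_moment_rec q k' w' +
      \sum_(p <- splits i w')
         limit_moment_rec q k' (rcons p.1 i) * limit_moment_rec q k' p.2
  end.

Definition limit_moment (R : pzSemiRingType) (q : bool -> R) w :=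
  limit_moment_rec q (size w) w.

Lemma limit_moment_recE (R : pzSemiRingType) (q : bool -> R) k w :
  (size w <= k)%N -> limit_moment_rec q k w = limit_moment q w.
Proof.
elim/ltn_ind: k w => -[|k] IH [|i w] //= wk.
rewrite /limit_moment /=; congr (_ * _ + _).
  by rewrite [LHS]IH.
rewrite big_seq [RHS]big_seq; apply: eq_bigr => p /splits_cat wE.
have s1 : (size (rcons p.1 i) <= size w)%N by rewrite wE size_rcons size_cat /= addnS ltnS leq_addr.
have s2 : (size p.2 <= size w)%N by rewrite wE size_cat /= addnS -addSn leq_addl.
have wk' : (size w < k.+1)%N by [].
by rewrite !(IH k) ?(leq_trans s1)// ?(leq_trans s2)// !(IH _ wk').
Qed.

(** The defining relation of the limit moments: the loop equation without the
    terms that vanish in the limit. *)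
Lemma limit_moment_cons (R : pzSemiRingType) (q : bool -> R) i w :
  limit_moment q (i :: w) = q i * limit_moment q w +
    \sum_(p <- splits i w) limit_moment q (rcons p.1 i) * limit_moment q p.2.
Proof.
rewrite {1}/limit_moment /=; congr (_ + _).
rewrite big_seq [RHS]big_seq; apply: eq_bigr => p /splits_cat wE.
rewrite !limit_moment_recE//.
  by rewrite wE size_cat /= addnS -addSn leq_addl.
by rewrite wE size_rcons size_cat /= addnS ltnS leq_addr.
Qed.

Section mean_loop.
Context d (T : measurableType d) (R : realType) (P : probability T R).
Context (n m : nat) (X : T -> 'M[R]_(n, m)) (D : bool -> 'M[R]_n).
Hypothesis Dsym : forall i, (D i)^T = D i.
Hypothesis Dorth : forall i j, D i *m D j = if i == j then D i else 0.
Hypothesis m_gt0 : (0 < m)%N.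
Hypothesis hX : iid_standard_gaussian_rows P X.

Definition mean_ntrs ws := \int[P]_w ntrs D (X w) ws.

Let entry w (b : 'I_n * 'I_m) := X w b.1 b.2.

Let entryK w : \matrix_(i < n, j < m) entry w (i, j) = X w.
Proof. by apply/matrixP => i j; rewrite mxE. Qed.

Lemma ntrs_all_moments ws : all_moments P (fun w => ntrs D (X w) ws).
Proof.
have := polyd_all_moments hX (@polyd_ntrs R n m D ws).
by congr all_moments; apply/funext => w; rewrite -[in RHS](entryK w).
Qed.

(** Integration by parts in the X at the left end of D_i X (wmx X V), followed
    by the computation of the divergence. *)
Lemma mean_ntrs_loop i V ws : mean_ntrs ((i :: V) :: ws) =
  \tr (D i) / n%:R * mean_ntrs (V :: ws) +
  \sum_(p <- splits i V)
    (n%:R^-1 * mean_ntrs ((rev p.1 ++ i :: p.2) :: ws) +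
     m%:R / n%:R * mean_ntrs (rcons p.1 i :: p.2 :: ws)) +
  n%:R^-1 * m%:R^-1 * \sum_(z <- picks ws) \sum_(p <- splits i z.1)
    (mean_ntrs ((rev V ++ i :: p.2 ++ p.1) :: z.2) +
     mean_ntrs (rcons (V ++ p.2 ++ p.1) i :: z.2)).
Proof.
have m0 : m%:R != 0 :> R by rewrite pnatr_eq0 -lt0n.
pose G b x := (D i *m (\matrix_(i < n, j < m) x (i, j)) *m
  wmx D (\matrix_(i < n, j < m) x (i, j)) V) b.1 b.2 *
  ntrs D (\matrix_(i < n, j < m) x (i, j)) ws.
have hG (b : 'I_n * 'I_m) := polydM (@polymx_DXw _ n m D i V b.1 b.2) (@polyd_ntrs R n m D ws).
have aX b : all_moments P (fun w => X w b.1 b.2) by exact: (entry_all_moments hX).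
have aG b : all_moments P (fun w => G b (entry w)) := polyd_all_moments hX (hG b).
have aE := ntrs_all_moments.
transitivity (\int[P]_w (m%:R^-1 * n%:R^-1 * \sum_b X w b.1 b.2 * G b (entry w))).
  apply: eq_Rintegral => w _; rewrite ntrs_cons ntr_wish /G entryK -[LHS]mulrA mulr_suml.
  by congr (_ * _); apply: eq_bigr => b _; rewrite mulrA.
rewrite meanZ; last by apply: all_moments_sum => b; exact: all_momentsM.
rewrite mean_sum; last by move=> b; exact: all_momentsM.
under eq_bigr => b _ do rewrite (polyd_stein hX _ _ (hG b)) -surjective_pairing.
have adG b := polyd_diff_all_moments hX b (hG b).
rewrite -mean_sum// -meanZ; last by apply: all_moments_sum => b; exact: adG.
(* The integrand left by integration by parts is a divergence. *)
transitivity (\int[P]_w loop_rhs D (X w) i V ws).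
  by apply: eq_Rintegral => w _; rewrite -loop_divergence// entryK.
rewrite /loop_rhs.
have a1 p : all_moments P (fun w => n%:R^-1 * ntrs D (X w) ((rev p.1 ++ i :: p.2) :: ws) +
     m%:R / n%:R * ntrs D (X w) (rcons p.1 i :: p.2 :: ws)).
  by apply: all_momentsD; exact: all_momentsZ.
have a2 z : all_moments P (fun w => \sum_(p <- splits i z.1)
    (ntrs D (X w) ((rev V ++ i :: p.2 ++ p.1) :: z.2) +
     ntrs D (X w) (rcons (V ++ p.2 ++ p.1) i :: z.2))).
  by apply: all_moments_sum => p; exact: all_momentsD.
rewrite meanD; last 2 first.
- by apply: all_momentsD; [exact: all_momentsZ|exact: all_moments_sum].
- by apply: all_momentsZ; exact: all_moments_sum.
rewrite meanD; last 2 first.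
- exact: all_momentsZ.
- exact: all_moments_sum.
congr (_ + _ + _).
- by rewrite meanZ.
- rewrite mean_sum//; apply: eq_bigr => p _.
  by rewrite meanD ?meanZ//; exact: all_momentsZ.
- rewrite meanZ; last exact: all_moments_sum.
  congr (_ * _); rewrite mean_sum//; apply: eq_bigr => z _.
  rewrite mean_sum; last by move=> p; exact: all_momentsD.
  by apply: eq_bigr => p _; rewrite meanD.
Qed.

Lemma mean_ntrs_nil : mean_ntrs [::] = 1.
Proof. by rewrite /mean_ntrs; under eq_Rintegral do rewrite /ntrs big_nil; exact: mean_cst. Qed.

Lemma mean_ntrs_cons_nil ws : mean_ntrs ([::] :: ws) = mean_ntrs ws.
Proof. by apply: eq_Rintegral => w _; rewrite ntrs_nil// pnatr_eq0 -lt0n. Qed.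
End mean_loop.

Lemma cvg_sum_seq (R : realType) (J : eqType) (r : seq J) (f : J -> nat -> R) (l : J -> R) :
  (forall j, j \in r -> f j n @[n --> \oo] --> l j) ->
  \sum_(j <- r) f j n @[n --> \oo] --> \sum_(j <- r) l j.
Proof.
elim: r => [|j r IH] h.
  by rewrite big_nil; under eq_fun do rewrite big_nil; exact: cvg_cst.
rewrite big_cons; under eq_fun do rewrite big_cons.
apply: cvgD; first by apply: h; rewrite mem_head.
by apply: IH => k kr; apply: h; rewrite inE kr orbT.
Qed.

Section mean_limit.
Context (R : realType) (d : nat -> measure_display).
Context (T : forall n, measurableType (d n)) (P : forall n, probability (T n) R).
Context (m : nat -> nat) (X : forall n, T n -> 'M[R]_(n, m n)).
Context (D : forall n, bool -> 'M[R]_n) (q : bool -> R).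
Hypothesis m_gt0 : forall n, (0 < m n)%N.
Hypothesis m_ratio : (m n)%:R / n%:R @[n --> \oo] --> (1 : R).
Hypothesis hX : forall n, iid_standard_gaussian_rows (P n) (@X n).
Hypothesis Dsym : forall n i, (D n i)^T = D n i.
Hypothesis Dorth : forall n i j, D n i *m D n j = if i == j then D n i else 0.
Hypothesis Dtr : forall i, \tr (D n i) / n%:R @[n --> \oo] --> q i.

(** Every term of the loop equation has fewer letters, so its convergence is
    known by induction. Products of traces have to be treated together, since
    the equation cuts and merges traces; the limit is a product, because the
    merging terms are of order 1/(nm). *)
Lemma mean_ntrs_cvg ws :
  mean_ntrs (P n) (@X n) (D n) ws @[n --> \oo] -->
  \prod_(w <- ws) limit_moment q w.
Proof.
have invn : n%:R^-1 @[n --> \oo] --> (0 : R).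
  apply/cvgr0Pnorm_lt => e e0; near=> n.
  have n0 : (0 < n)%N by near: n; exact: nbhs_infty_gt.
  rewrite ger0_norm ?invr_ge0// invf_plt ?posrE ?ltr0n//.
  near: n; exact: nbhs_infty_gtr.
have invnm : n%:R^-1 * (m n)%:R^-1 @[n --> \oo] --> (0 : R).
  apply/cvgr0Pnorm_lt => e e0; near=> n.
  rewrite normrM; apply: (@le_lt_trans _ _ `|n%:R^-1|).
    rewrite ler_piMr// ger0_norm ?invr_ge0// invf_le1 ?ltr0n// ler1n//.
  by near: n; move/cvgr0Pnorm_lt : invn; apply.
(* Outer induction on the number of letters; the inner one, on the list,
   disposes of empty words, which contribute a factor 1 and no letter. *)
have [k] := ubnP (letters ws); elim: k ws => // k IHk.
elim=> [|w ws IHs] ltk.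
  rewrite big_nil; under eq_fun do rewrite mean_ntrs_nil; exact: cvg_cst.
case: w ltk => [|i V] ltk.
  rewrite big_cons /limit_moment /= mul1r.
  under eq_fun do rewrite mean_ntrs_cons_nil//.
  exact: IHs.
under eq_fun do rewrite mean_ntrs_loop//.
have IH vs : (letters vs < letters ((i :: V) :: ws))%N ->
    mean_ntrs (P n) (@X n) (D n) vs @[n --> \oo] --> \prod_(w <- vs) limit_moment q w.
  by move=> h; apply: IHk; apply: leq_trans h _; rewrite -ltnS.
pose L vs := \prod_(w <- vs) limit_moment q w.
(* The limit in the shape of the loop equation, the vanishing terms kept with
   coefficient 0. *)
have limE : \prod_(w <- (i :: V) :: ws) limit_moment q w =
    q i * L (V :: ws) +
    \sum_(p <- splits i V) (0 * L ((rev p.1 ++ i :: p.2) :: ws) +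
       1 * L (rcons p.1 i :: p.2 :: ws)) +
    0 * \sum_(z <- picks ws) \sum_(p <- splits i z.1)
      (L ((rev V ++ i :: p.2 ++ p.1) :: z.2) + L (rcons (V ++ p.2 ++ p.1) i :: z.2)).
  rewrite mul0r addr0 big_cons limit_moment_cons mulrDl /L big_cons mulrA; congr (_ + _).
  rewrite mulr_suml; apply: eq_bigr => p _.
  by rewrite mul0r add0r mul1r !big_cons mulrA.
rewrite limE.
apply: cvgD; first apply: cvgD.
- by apply: cvgM => //; apply: IH; rewrite /letters /= addSn.
- apply: cvg_sum_seq => p /splits_cat VE.
  apply: cvgD; apply: cvgM => //; apply: IH.
    by rewrite /letters /= VE !size_cat size_rev/= addSn.
  by rewrite /letters /= VE !size_cat size_rcons/= !addSn !addnS !addnA.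
- apply: cvgM => //; apply: cvg_sum_seq => z /picks_letters zE.
  apply: cvg_sum_seq => p /splits_cat VE.
  have e : letters ws = (size p.1 + (size p.2).+1 + letters z.2)%N.
    by rewrite -zE; congr (_ + _)%N; rewrite VE size_cat.
  apply: cvgD; apply: IH; rewrite /letters /= -/(letters ws) -/(letters z.2) e.
    by rewrite size_cat size_rev /= size_cat; lia.
  rewrite size_rcons !size_cat addnS !addSn !addnS !addnA !ltnS.
  by rewrite [(size V + size p.2 + _)%N]addnAC.
Unshelve. all: by end_near. Qed.
End mean_limit.

(** * The free algebra on two letters *)

(** The free algebra on two letters, given by what is used of it: the words
    span, and linear forms can be prescribed on them at will. *)
Record word_algebra (C : comNzRingType) := WordAlgebra {
  wa_alg :> algType C;
  wa_word : seq bool -> wa_alg;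
  wa_lin : (seq bool -> C) -> {scalar wa_alg};
  wa_word_nil : wa_word [::] = 1;
  wa_word_cat : forall v w, wa_word (v ++ w) = wa_word v * wa_word w;
  wa_ind : forall Q : wa_alg -> Prop, (forall w, Q (wa_word w)) ->
    (forall c x y, Q x -> Q y -> Q (c *: x + y)) -> forall x, Q x;
  wa_lin_word : forall f w, wa_lin f (wa_word w) = f w
}.

Section free_algebra.
Variable C : comNzRingType.

Let M := malg (fmonom bool) C.

Let mkmalgUE (k : fmonom bool) (a : C) : mkmalgU k a = a *: mkmalgU k 1 :> M.
Proof.
apply/malgP => l.
by rewrite (mcoeffZ a (mkmalgU k 1 : M) l) (mcoeffU k a l) (mcoeffU k 1 l) mulrnAr mulr1. Qed.

Let scaleAr (c : C) (x y : M) : c *: (x * y) = x * (c *: y).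
Proof.
rewrite [RHS]malgM_def (fgmullw (finmap.fsubset_refl _) (msuppZ_le c y)).
rewrite [x * y]malgM_def fgmull scaler_sumr; apply: eq_bigr => k _.
rewrite scaler_sumr; apply: eq_bigr => l _.
rewrite (mkmalgUE _ (mcoeff k x * mcoeff l y)) scalerA [RHS]mkmalgUE.
by rewrite (mcoeffZ c y l) mulrCA.
Qed.

Let mulU (v w : seq bool) : mkmalgU (FMonom (v ++ w)) 1 =
  mkmalgU (FMonom v) 1 * mkmalgU (FMonom w) 1 :> M.
Proof. by rewrite [RHS]malgM_def fgmulUU mulr1; congr mkmalgU; rewrite [RHS]fmmulE. Qed.

Let oneU : mkmalgU (FMonom [::]) 1 = 1 :> M.
Proof. by congr mkmalgU; exact/esym/fmoneE. Qed.

Let ind (Q : M -> Prop) : (forall w, Q (mkmalgU (FMonom w) 1)) ->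
  (forall c x y, Q x -> Q y -> Q (c *: x + y)) -> forall x, Q x.
Proof.
move=> Qw Qlin x.
have Q0 : Q 0 by rewrite -(addNr (mkmalgU (FMonom [::]) 1)) -scaleN1r; exact: Qlin.
rewrite (monalgE x); elim: (finmap.enum_fset _) => [|k r IH]; first by rewrite big_nil.
by rewrite big_cons mkmalgUE; apply: Qlin => //; rewrite -(fmK k).
Qed.

Let lin (f : seq bool -> C) (x : M) : C := mmap idfun (fun k : fmonom bool => f k) x.

Let lin_is_linear f : scalar (lin f).
Proof.
move=> c x y; rewrite /lin raddfD /=; congr (_ + _).
rewrite (mmapEw (msuppZ_le _ _)) mmapE mulr_sumr; apply: eq_bigr => k _ /=.
by rewrite mcoeffZ mulrA.
Qed.

Let linU f w : lin f (mkmalgU (FMonom w) 1) = f w.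
Proof. by rewrite /lin mmapU mul1r. Qed.

Definition freealg : Type := M.
HB.instance Definition _ := GRing.Lalgebra.on freealg.
HB.instance Definition _ := GRing.Lalgebra_isAlgebra.Build C freealg scaleAr.

Let flin (f : seq bool -> C) (x : freealg) : C := lin f x.
HB.instance Definition _ f :=
  GRing.isLinear.Build C freealg C *%R (flin f) (lin_is_linear f).

(** The monoid algebra of the free monoid; the word w is the generator of the
    monoid element w. *)
Lemma free_word_algebra : word_algebra C.
Proof.
apply: (@WordAlgebra C freealg (fun w => mkmalgU (FMonom w) 1)
  (fun f => flin f : {scalar freealg})).
- exact: oneU.
- exact: mulU.
- exact: ind.
- exact: linU.
Qed.
End free_algebra.

(** * The Schwinger-Dyson equation *)
Section free_difference_quotient.
Variables (C : comNzRingType) (A : word_algebra C) (q : bool -> C).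
Local Notation fword := (@wa_word C A).
Local Notation flin := (@wa_lin C A).
Local Notation phi := (flin (limit_moment q)).
Local Notation x := (fun i : bool => fword [:: i]).

Lemma splits_cat_big (i : bool) w1 w2 (F : seq bool -> seq bool -> C) :
  \sum_(p <- splits i (w1 ++ w2)) F p.1 p.2 =
  \sum_(p <- splits i w1) F p.1 (p.2 ++ w2) +
  \sum_(p <- splits i w2) F (w1 ++ p.1) p.2.
Proof.
elim: w1 F => [|j w1 IH] F /=; first by rewrite big_nil add0r.
rewrite !big_cat /= !big_map /= (IH (fun a b => F (j :: a) b)) addrA; congr (_ + _ + _).
by case: eqP => _; rewrite ?big_nil ?big_seq1.
Qed.

(** The number (phi ⊗ phi)((l ⊗ 1) d_i g (1 ⊗ r)), where d_i is
    the derivation into the tensor square that maps a word to the sum of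
    w' x_i ⊗ w'' over its decompositions w' i w''. Contracting at once with l,
    r and phi avoids the tensor product. *)
Definition fdq i (l r g : A) : C :=
  flin (fun w => \sum_(p <- splits i w) phi (l * fword p.1 * x i) * phi (fword p.2 * r)) g.

Lemma fdq_linear i l r : scalar (fdq i l r).
Proof. by move=> c g h; rewrite /fdq linearP. Qed.

Lemma fdqD i l r g h : fdq i l r (g + h) = fdq i l r g + fdq i l r h.
Proof. by have := fdq_linear i l r 1 g h; rewrite scale1r mul1r. Qed.

Lemma fdqZ i l r c g : fdq i l r (c *: g) = c * fdq i l r g.
Proof. by rewrite /fdq linearZ. Qed.

Lemma fdq0 i l r : fdq i l r 0 = 0.
Proof. by rewrite /fdq linear0. Qed.

Lemma fdq_word i l r w : fdq i l r (fword w) =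
  \sum_(p <- splits i w) phi (l * fword p.1 * x i) * phi (fword p.2 * r).
Proof. exact: wa_lin_word. Qed.

Lemma fdq_linear_l i r g c l l' :
  fdq i (c *: l + l') r g = c * fdq i l r g + fdq i l' r g.
Proof.
elim/(@wa_ind C A): g => [w|d y z hy hz].
  rewrite !fdq_word mulr_sumr -big_split; apply: eq_bigr => p _ /=.
  by rewrite !mulrDl linearD -!scalerAl linearZ /= mulrDl mulrA.
by rewrite !fdqD !fdqZ hy hz !mulrDr [d * (c * _)]mulrCA addrACA.
Qed.

Lemma fdq_linear_r i l g c r r' :
  fdq i l (c *: r + r') g = c * fdq i l r g + fdq i l r' g.
Proof.
elim/(@wa_ind C A): g => [w|d y z hy hz].
  rewrite !fdq_word mulr_sumr -big_split; apply: eq_bigr => p _ /=.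
  by rewrite !mulrDr linearD -!scalerAr linearZ /= mulrDr mulrCA.
by rewrite !fdqD !fdqZ hy hz !mulrDr [d * (c * _)]mulrCA addrACA.
Qed.

(** The Leibniz rule of the derivation d_i. *)
Lemma fdqM i l r g h : fdq i l r (g * h) = fdq i l (h * r) g + fdq i (l * g) r h.
Proof.
elim/(@wa_ind C A): g => [w|d y z hy hz]; last first.
  rewrite mulrDl -scalerAl fdqD fdqZ hy hz fdqD fdqZ.
  by rewrite [l * (_ + _)]mulrDr -scalerAr fdq_linear_l mulrDr addrACA.
elim/(@wa_ind C A): h => [v|d y z hy hz]; last first.
  rewrite mulrDr -scalerAr fdqD fdqZ hy hz fdqD fdqZ.
  by rewrite [(_ + _) * r]mulrDl -scalerAl fdq_linear_r mulrDr addrACA.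
rewrite -wa_word_cat !fdq_word (splits_cat_big i w v
  (fun a b => phi (l * fword a * x i) * phi (fword b * r))).
by congr (_ + _); apply: eq_bigr => p _; rewrite wa_word_cat !mulrA.
Qed.

Lemma fdq1 i l r : fdq i l r 1 = 0.
Proof. by rewrite -wa_word_nil fdq_word big_nil. Qed.

Lemma fdq_var i j l r : fdq i l r (x j) = if j == i then phi (l * x i) * phi r else 0.
Proof.
rewrite fdq_word /=; case: eqP => _; rewrite ?big_nil// big_seq1 /=.
by rewrite wa_word_nil mulr1 mul1r.
Qed.

Lemma phi1 : phi 1 = 1.
Proof. by rewrite -wa_word_nil wa_lin_word. Qed.

(** The recursion of limit moments, extended linearly from words. *)
Lemma schwinger_dyson i g : phi (x i * g) = q i * phi g + fdq i 1 1 g.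
Proof.
elim/(@wa_ind C A): g => [w|c y z hy hz].
  rewrite -wa_word_cat !wa_lin_word limit_moment_cons fdq_word; congr (_ + _).
  apply: eq_bigr => p _.
  by rewrite mul1r mulr1 -wa_word_cat !wa_lin_word cats1.
by rewrite mulrDr -scalerAr !linearD !linearZ /= fdqD fdqZ hy hz !mulrDr [c * (q i * _)]mulrCA addrACA.
Qed.

Definition peval i (p : {poly C}) : A := horner_alg (x i) p.

Lemma pevalMXaddC i p c : peval i (p * 'X + c%:P) = peval i p * x i + c *: 1.
Proof. by rewrite /peval rmorphD rmorphM /= horner_algX horner_algC. Qed.

Lemma pevalMXaddC' i p c : peval i (p * 'X + c%:P) = x i * peval i p + c *: 1.
Proof. by rewrite mulrC /peval rmorphD rmorphM /= horner_algX horner_algC. Qed.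

Lemma fdq_peval_neq i j l r (p : {poly C}) : i != j -> fdq i l r (peval j p) = 0.
Proof.
move=> ij; elim/poly_ind: p r => [|p c IH] r.
  by rewrite /peval rmorph0 fdq0.
rewrite pevalMXaddC fdqD fdqZ fdq1 mulr0 addr0 fdqM IH add0r fdq_var.
by rewrite eq_sym (negbTE ij).
Qed.

(** The derivation maps polynomials in x_i to tensors of polynomials in x_i;
    the degree of the right-hand one drops, and this carries the induction in
    the proof of freeness. *)
Lemma fdq_peval_eq i (p : {poly C}) : exists s : seq ({poly C} * {poly C}),
  (forall ab, ab \in s -> (size ab.2 <= (size p).-1)%N) /\
  forall l r, fdq i l r (peval i p) =
    \sum_(ab <- s) phi (l * peval i ab.1) * phi (peval i ab.2 * r).
Proof.
elim/poly_ind: p => [|p c [s [ss IH]]].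
  by exists [::]; split => // l r; rewrite /peval rmorph0 fdq0 big_nil.
have [->|p0] := eqVneq p 0.
  exists [::]; split => // l r.
  by rewrite mul0r add0r big_nil /peval horner_algC fdqZ fdq1 mulr0.
exists ((p * 'X, 1) :: [seq (ab.1, ab.2 * 'X) | ab <- s]); split.
  move=> ab; rewrite size_MXaddC (negbTE p0)/= inE => /orP[/eqP ->|/mapP[cd cds ->]] /=.
    by rewrite size_poly1 size_poly_gt0.
  apply: leq_trans (size_polyMleq _ _) _; rewrite size_polyX addn2 /=.
  by apply: leq_ltn_trans (ss _ cds) _; rewrite prednK// size_poly_gt0.
move=> l r; rewrite pevalMXaddC fdqD fdqZ fdq1 mulr0 addr0 fdqM IH fdq_var eqxx.
rewrite big_cons big_map addrC /= /peval rmorph1 mul1r rmorphM /= horner_algX mulrA.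
congr (_ + _); apply: eq_bigr => ab _.
by rewrite rmorphM /= horner_algX !mulrA.
Qed.

End free_difference_quotient.

(** * Freeness of the two letters *)
Section freeness.
Context (C : comNzRingType) (A : word_algebra C) (q : bool -> C).
Local Notation phi := (wa_lin A (limit_moment q)).
Local Notation peval := (@peval C A).
Implicit Types (i j : bool) (p r : {poly C}) (s : seq (bool * {poly C})).

Definition pevals s : A := \prod_(a <- s) peval a.1 a.2.

Definition alternating s := sorted (fun a b : bool * {poly C} => a.1 != b.1) s.

Definition centered s := all (fun a => phi (peval a.1 a.2) == 0) s.

Lemma pevals_cons i p s : pevals ((i, p) :: s) = peval i p * pevals s.
Proof. by rewrite /pevals big_cons. Qed.

Lemma pevals_cat s s' : pevals (s ++ s') = pevals s * pevals s'.
Proof. by rewrite /pevals big_cat. Qed.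

Definition center i p := p - (phi (peval i p))%:P.

Lemma peval_center i p : peval i p = peval i (center i p) + phi (peval i p) *: 1.
Proof. by rewrite /center /peval rmorphB /= horner_algC subrK. Qed.

Lemma phi_center i p : phi (peval i (center i p)) = 0.
Proof.
have := congr1 phi (peval_center i p); rewrite linearD linearZ /= phi1 mulr1.
by move/eqP; rewrite -subr_eq subrr eq_sym => /eqP.
Qed.

Lemma size_center i p k : (size p <= k)%N -> (size (center i p) <= k)%N.
Proof.
have [->|p0] := eqVneq p 0.
  by rewrite /center /peval rmorph0 linear0 subr0.
move=> pk; rewrite /center; apply: leq_trans (size_polyD _ _) _.
rewrite geq_max pk size_polyN; apply: leq_trans (size_polyC_leq1 _) _.
by apply: leq_trans pk; rewrite size_poly_gt0.
Qed.

(** The claim for products of k.+1 factors whose first one has degree less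
    than N. The induction is lexicographic in (k, N). *)
Let vanishes k N := forall i p s, size s = k -> (size p <= N)%N ->
  alternating ((i, p) :: s) -> centered ((i, p) :: s) ->
  phi (pevals ((i, p) :: s)) = 0.

Let vanishes_seq k s : (forall k', (k' < k)%N -> forall N, vanishes k' N) ->
  (0 < size s <= k)%N -> alternating s -> centered s -> phi (pevals s) = 0.
Proof.
by case: s => [//|[i p] s] H /= sk alts cs; exact: (H _ sk (size p)).
Qed.

(** A first factor that is not centred: its mean multiplies a shorter product
    of centred factors, and the rest is covered by the hypotheses. *)
Let vanishes_first k N i r s :
  (forall k', (k' < k)%N -> forall N', vanishes k' N') -> vanishes k N ->
  (0 < size s <= k)%N -> (size r <= N)%N -> alternating ((i, r) :: s) ->
  centered s -> phi (peval i r * pevals s) = 0.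
Proof.
move=> Hk HN /andP[s0 sk] rN alts cs.
rewrite peval_center mulrDl linearD -scalerAl mul1r linearZ /=.
rewrite (vanishes_seq Hk _ _ cs) ?s0//; last by move: alts; case: (s) => //= a s' /andP[].
rewrite mulr0 addr0 -pevals_cons.
have alts' : alternating ((i, center i r) :: s) by move: alts; case: (s).
have cs' : centered ((i, center i r) :: s) by rewrite /= phi_center eqxx.
move: sk; rewrite leq_eqVlt => /orP[/eqP sk|sk].
  by apply: HN => //; exact: size_center.
exact: (Hk _ sk (size (center i r))).
Qed.

(** Both end factors may be non-centred. This is the shape left when the
    derivation hits a later factor in x_i. *)
Let vanishes_ends k N i r a s :
  (forall k', (k' < k)%N -> forall N', vanishes k' N') -> vanishes k N ->
  (0 < size s < k)%N -> (size r <= N)%N ->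
  alternating ((i, r) :: rcons s (i, a)) -> centered s ->
  phi (peval i r * pevals s * peval i a) = 0.
Proof.
move=> Hk HN /andP[s0 sk] rN alts cs.
rewrite [peval i a]peval_center mulrDr linearD -scalerAr mulr1 linearZ /=.
have alts1 : alternating ((i, r) :: s).
  by move: alts; rewrite /alternating -cats1 -cat_cons => /cat_sorted2[].
rewrite (vanishes_first Hk HN _ rN alts1 cs) ?s0 1?ltnW// mulr0 addr0 -mulrA.
have -> : pevals s * peval i (center i a) = pevals (rcons s (i, center i a)).
  by rewrite -cats1 pevals_cat /pevals big_seq1.
apply: (vanishes_first Hk HN) => //; first by rewrite size_rcons.
  move: alts; rewrite /alternating /= !rcons_path => /andP[-> /=].
  by [].
by rewrite /centered all_rcons /= phi_center eqxx.
Qed.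

(** By the Leibniz rule the derivation acts on one factor after the other; the
    factors already passed are collected in pre. If it acts on a factor in
    x_i, the left leg is phi of the product up to that factor, which
    vanishes. *)
Let fdq_walk k N i r pre post :
  (forall k', (k' < k)%N -> forall N', vanishes k' N') -> vanishes k N ->
  (size r <= N)%N -> size (pre ++ post) = k ->
  alternating ((i, r) :: pre ++ post) -> centered (pre ++ post) ->
  @fdq C A q i (peval i r * pevals pre) 1 (pevals post) = 0.
Proof.
move=> Hk HN rN; elim: post pre => [|[j p] post IH] pre sk alts cs.
  by rewrite /pevals big_nil fdq1.
rewrite pevals_cons fdqM mulr1.
have h2 : @fdq C A q i (peval i r * pevals pre * peval j p) 1 (pevals post) = 0.
  rewrite -mulrA.
  have -> : pevals pre * peval j p = pevals (rcons pre (j, p)).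
    by rewrite -cats1 pevals_cat /pevals big_seq1.
  by apply: IH; rewrite cat_rcons.
rewrite h2 addr0.
have [ij|ij] := eqVneq i j; last exact: fdq_peval_neq.
rewrite -ij in alts *.
have [t [_ ->]] := @fdq_peval_eq C A q i p.
rewrite big1// => ab _.
(* The word (i, r) :: pre ++ (i, p) :: post alternates, so some factor in the
   other variable separates the two occurrences of i. *)
have pre0 : (0 < size pre)%N.
  by case: (pre) alts => [|//]; rewrite /alternating /= eqxx.
rewrite (vanishes_ends Hk HN _ rN) ?mul0r//.
- by rewrite pre0 -sk size_cat /= addnS ltnS leq_addr.
- move: alts; rewrite -cat_rcons /alternating -cat_cons => /cat_sorted2[+ _].
  by rewrite /= !rcons_path.
- by move: cs; rewrite /centered all_cat => /andP[].
Qed.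

(** In the Schwinger-Dyson equation for x_i r(x_i) s, the term q_i phi(r s)
    and the terms in which r is differentiated contain phi(b(x_i) s) with b of
    degree at most that of r, hence smaller than that of the first factor;
    the terms in which s is differentiated vanish by fdq_walk. *)
Lemma centered_alternating_vanishes s : (0 < size s)%N -> alternating s ->
  centered s -> phi (pevals s) = 0.
Proof.
suff H k N : vanishes k N.
  by move=> s0 alts cs; apply: (vanishes_seq (k := size s)) => //; rewrite s0 leqnn.
elim/ltn_ind: k N {s} => k Hk; elim=> [|N HN] i p s sk pN alts /= /andP[cp cs].
  move: pN; rewrite leqn0 size_poly_eq0 => /eqP ->.
  by rewrite pevals_cons /peval rmorph0 mul0r linear0.
have [k0|k0] := posnP k.
  have -> : s = [::] by apply: size0nil; rewrite sk.
  by rewrite /pevals big_seq1; exact/eqP.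
(* Writing p = X r + c, the constant c multiplies a shorter product; the
   Schwinger-Dyson equation applies to x_i r(x_i) pevals s. *)
elim/poly_ind: p cp pN alts => [|r c _] cp pN alts.
  by rewrite pevals_cons /peval rmorph0 mul0r linear0.
have rN : (size r <= N)%N.
  have [->|r0] := eqVneq r 0; first by rewrite size_poly0.
  by move: pN; rewrite size_MXaddC (negbTE r0).
have altr r' : alternating ((i, r') :: s) by move: alts; case: (s).
have alts' : alternating s by move: alts; case: (s) => //= a s' /andP[].
have sk' : (0 < size s <= k)%N by rewrite sk k0 leqnn.
rewrite pevals_cons pevalMXaddC' mulrDl linearD -scalerAl mul1r linearZ /=.
rewrite (vanishes_seq Hk sk' alts' cs) mulr0 addr0 -mulrA schwinger_dyson.
rewrite (vanishes_first Hk HN sk' rN (altr r) cs) mulr0 add0r fdqM mulr1 mul1r.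
have := @fdq_walk k N i r [::] s Hk HN rN sk (altr r) cs.
rewrite {1}/pevals big_nil mulr1 => ->; rewrite addr0.
have [t [tr ->]] := @fdq_peval_eq C A q i r.
rewrite big_seq big1// => ab abt.
rewrite (vanishes_first Hk HN sk' _ (altr _) cs) ?mulr0//.
by apply: leq_trans (tr _ abt) _; apply: leq_trans (leq_pred _) rN.
Qed.
End freeness.

Section free_cumulants.
Context (C : comNzRingType) (A : algType C) (phi : {scalar A}).
Implicit Types n N : nat.

(** * Existence of free cumulants *)

(** The moment-cumulant relation solved for the contribution of the one-block
    partition. All other partitions have smaller blocks; N bounds the number
    of arguments and makes the recursion structural. *)
Fixpoint cumulant_rec N : forall n, ('I_n -> A) -> C :=
  if N is N'.+1 then fun n a =>
    phi (\prod_(i < n) a i) -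
    \sum_(pi : {set {set 'I_n}} | NC pi && (pi != [set [set: 'I_n]]%SET))
       \prod_(V in pi) cumulant_rec N' (fun k : 'I_#|V| => a (enum_val k))
  else fun _ _ => 0.

Definition cumulant n (a : 'I_n -> A) := cumulant_rec n a.

(** In each product over blocks exactly one factor depends on the argument
    that varies. *)
Lemma cumulant_rec_multilinear N n : multilinear_form (@cumulant_rec N n).
Proof.
elim: N n => [|N IH] n a i c x y /=; first by rewrite mulr0 addr0.
set ax := [eta a with i |-> x]; set ay := [eta a with i |-> y].
set az := [eta a with i |-> c *: x + y].
have E0 z j : j != i -> [eta a with i |-> z] j = a j by move=> /negbTE h; rewrite /= h.
have Ei z : [eta a with i |-> z] i = z by rewrite /= eqxx.
have lin (L : A) (r : A) : phi (L * (c *: x + y) * r) = c * phi (L * x * r) + phi (L * y * r).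
  by rewrite mulrDr mulrDl linearD -scalerAr -scalerAl linearZ.
have [L [r prodE]] : exists L r : A, forall z,
    \prod_(j < n) [eta a with i |-> z] j = L * z * r.
  have : i \in index_enum 'I_n by rewrite mem_index_enum.
  have : uniq (index_enum 'I_n) by exact: index_enum_uniq.
  move: (index_enum _) => s us /path.splitPr si.
  case: si us => s1 s2; rewrite cat_uniq /= negb_or.
  move=> /and3P[_ /andP[is1 _] /andP[is2 _]].
  exists (\prod_(j <- s1) a j), (\prod_(j <- s2) a j) => z.
  rewrite big_cat big_cons /= eqxx mulrA; congr (_ * _ * _).
    rewrite big_seq [RHS]big_seq; apply: eq_bigr => j js.
    by case: eqP => // ji; rewrite -ji js in is1.
  rewrite big_seq [RHS]big_seq; apply: eq_bigr => j js.
  by case: eqP => // ji; rewrite -ji js in is2.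
have h1 : phi (\prod_(j < n) az j) = c * phi (\prod_(j < n) ax j) + phi (\prod_(j < n) ay j).
  by rewrite !prodE lin.
rewrite h1 mulrBr mulr_sumr addrACA -opprD -big_split; congr (_ - _).
apply: eq_bigr => pi /andP[/andP[ppi _] _].
(* Only the block V0 containing i sees the i-th argument. *)
have [V0 [V0pi iV0]] : exists V, V \in pi /\ i \in V.
  have : i \in finset.cover pi by rewrite (finset.cover_partition ppi) inE.
  by case/finset.bigcupP => V; exists V.
have other z V : V \in pi -> V != V0 ->
    cumulant_rec N (fun k : 'I_#|V| => [eta a with i |-> z] (enum_val k)) =
    cumulant_rec N (fun k : 'I_#|V| => a (enum_val k)).
  move=> Vpi VV0; congr cumulant_rec; apply/funext => k; apply: E0.
  apply: contra VV0 => /eqP kE; apply/eqP.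
  have iV : i \in V by rewrite -kE enum_valP.
  have /and3P[_ tpi _] := ppi.
  by rewrite -(finset.def_pblock tpi Vpi iV) (finset.def_pblock tpi V0pi iV0).
have main z : cumulant_rec N (fun k : 'I_#|V0| => [eta a with i |-> z] (enum_val k)) =
    cumulant_rec N [eta (fun k : 'I_#|V0| => a (enum_val k)) with enum_rank_in iV0 i |-> z].
  congr cumulant_rec; apply/funext => k /=.
  have -> : (enum_val k == i) = (k == enum_rank_in iV0 i); last by [].
  apply/eqP/eqP => [kE|->]; last by rewrite enum_rankK_in.
  by rewrite -[LHS](enum_valK_in iV0) kE.
rewrite !(bigD1 V0 V0pi) /= /ax /ay /az !main IH mulrDl mulrA.
by congr (_ * _ + _ * _); apply: eq_bigr => V /andP[Vpi VV0]; rewrite !other.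
Qed.

Lemma partition_block_proper n (pi : {set {set 'I_n}}) (V : {set 'I_n}) :
  finset.partition pi [set: 'I_n]%SET -> pi != [set [set: 'I_n]]%SET -> V \in pi ->
  (0 < #|V| < n)%N.
Proof.
move=> ppi pi1 Vpi; have /and3P[/eqP cpi tpi pi0] := ppi.
have V0 : V != finset.set0 by apply: contra pi0 => /eqP <-.
rewrite card_gt0 V0 /= ltn_neqAle -[X in _ && (_ <= X)%N]card_ord max_card andbT.
apply: contra pi1 => /eqP Vn.
have VT : V = [set: 'I_n]%SET.
  by apply/eqP; rewrite eqEcard finset.subsetT cardsT card_ord Vn leqnn.
rewrite finset.eqEsubset; apply/andP; split; apply/fintype.subsetP => W; rewrite !inE; last first.
  by move/eqP ->; rewrite -VT.
move=> Wpi; have /set0Pn[i iW] : W != finset.set0 by apply: contra pi0 => /eqP <-.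
by rewrite -VT -(finset.def_pblock tpi Wpi iW) -(finset.def_pblock tpi Vpi (_ : i \in V)) // VT inE.
Qed.

Lemma cumulant_recE N n (a : 'I_n -> A) : (0 < n <= N)%N ->
  cumulant_rec N a = cumulant a.
Proof.
elim/ltn_ind: N n a => -[|N] IH [|n] a //; rewrite ltnS /= => nN.
rewrite /cumulant /=; congr (_ - _).
apply: eq_bigr => pi /andP[/andP[ppi _] pi1]; apply: eq_bigr => V Vpi.
have /andP[V0 Vn] := partition_block_proper ppi pi1 Vpi.
have Vn' : (0 < #|V| <= n)%N by rewrite V0.
have VN : (0 < #|V| <= N)%N by rewrite V0 -ltnS (leq_trans Vn nN).
by rewrite (IH N (ltnSn N) _ _ VN) (IH n nN _ _ Vn').
Qed.

Lemma cumulant_cast (f : forall n, ('I_n -> A) -> C) n n' (e : n' = n)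
    (a : 'I_n -> A) (b : 'I_n' -> A) :
  (forall k, b k = a (cast_ord e k)) -> f n' b = f n a.
Proof.
case: n / e a => a h; congr f; apply/funext => k.
by rewrite h cast_ord_id.
Qed.

Lemma NC_setT n : (0 < n)%N -> NC [set [set: 'I_n]]%SET.
Proof.
move=> n0; apply/andP; split.
  apply/and3P; split; first by rewrite /finset.cover big_set1.
    by apply/finset.trivIsetP => V W; rewrite !inE => /eqP -> /eqP ->; rewrite eqxx.
  by rewrite inE eq_sym -card_gt0 cardsT card_ord.
apply/forall_inP => V; rewrite inE => /eqP ->.
by apply/forall_inP => W; rewrite inE => /eqP ->; rewrite eqxx.
Qed.

Lemma cumulant_split n (a : 'I_n -> A) : (0 < n)%N ->
  cumulant a = phi (\prod_(i < n) a i) -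
    \sum_(pi : {set {set 'I_n}} | NC pi && (pi != [set [set: 'I_n]]%SET))
       \prod_(V in pi) cumulant (fun k : 'I_#|V| => a (enum_val k)).
Proof.
case: n a => // n a _; rewrite {1}/cumulant /=; congr (_ - _).
apply: eq_bigr => pi /andP[/andP[ppi _] pi1]; apply: eq_bigr => V Vpi.
have /andP[V0 Vn] := partition_block_proper ppi pi1 Vpi.
by rewrite cumulant_recE// V0.
Qed.

Lemma moment_cumulant n (a : 'I_n -> A) : (0 < n)%N ->
  phi (\prod_(i < n) a i) =
  \sum_(pi : {set {set 'I_n}} | NC pi)
     \prod_(V in pi) cumulant (fun k : 'I_#|V| => a (enum_val k)).
Proof.
move=> n0; rewrite (bigD1 [set [set: 'I_n]]%SET (NC_setT n0)) /= big_set1.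
have e : #|[set: 'I_n]%SET| = n by rewrite cardsT card_ord.
rewrite (@cumulant_cast cumulant _ _ e a); first by rewrite cumulant_split// subrK.
move=> k; congr a; apply/val_inj; rewrite /=.
rewrite (enum_val_nth (cast_ord e k)) /=.
have -> : enum [set: 'I_n]%SET = enum 'I_n by rewrite enum_setT enumT.
exact: (nth_enum_ord _ (ltn_ord (cast_ord e k))).
Qed.

(** The cumulants are determined by the moments, by induction on the order. *)
Lemma constant_cumulant (x : A) (lambda : C) :
  (forall n, (0 < n)%N -> phi (x ^+ n) =
     \sum_(pi : {set {set 'I_n}} | NC pi) lambda ^+ #|pi|) ->
  forall n, (0 < n)%N -> cumulant (fun _ : 'I_n => x) = lambda.
Proof.
move=> h n; elim/ltn_ind: n => n IH n0.
rewrite cumulant_split// prodr_const card_ord h//.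
rewrite (bigD1 [set [set: 'I_n]]%SET (NC_setT n0)) /= cards1 expr1.
apply/eqP; rewrite subr_eq; apply/eqP; congr (_ + _).
apply: eq_bigr => pi /andP[/andP[ppi _] pi1].
rewrite -prodr_const; apply: eq_bigr => V Vpi.
by have /andP[V0 Vn] := partition_block_proper ppi pi1 Vpi; rewrite IH.
Qed.

End free_cumulants.

(** * Splitting a non-crossing partition along its first block *)
Section noncrossing_partitions.
Local Open Scope set_scope.
Variable n : nat.
Implicit Types (D U V W : {set 'I_n}) (pi rho sigma : {set {set 'I_n}}).

Definition ncpart D pi := finset.partition pi D && noncrossing pi.

Lemma ncpartP D pi : reflect
  [/\ forall V, V \in pi -> V \subset D,
      forall x, x \in D -> exists2 V, V \in pi & x \in V,
      forall V W x, V \in pi -> W \in pi -> x \in V -> x \in W -> V = W,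
      forall V, V \in pi -> exists x, x \in V &
      forall V W i j k l, V \in pi -> W \in pi -> i \in V -> k \in V ->
        j \in W -> l \in W -> (i < j)%N -> (j < k)%N -> (k < l)%N -> V = W]
  (ncpart D pi).
Proof.
apply: (iffP andP) => [[/and3P[/eqP cpi /finset.trivIsetP tpi pi0] nc]|[sub cov dis ne nc]].
  split.
  - by move=> V Vpi; rewrite -cpi; exact: finset.bigcup_sup.
  - by move=> x; rewrite -cpi => /finset.bigcupP[V]; exists V.
  - move=> V W x Vpi Wpi xV xW; apply/eqP; apply: contraT => VW.
    have := tpi V W Vpi Wpi VW; rewrite -finset.setI_eq0 => /eqP/setP/(_ x).
    by rewrite !inE xV xW.
  - move=> V Vpi; apply/finset.set0Pn; by apply: contra pi0 => /eqP <-.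
  - move=> V W i j k l Vpi Wpi iV kV jW lW ij jk kl; apply/eqP; apply: contraT => VW.
    move/forall_inP : nc => /(_ V Vpi)/forall_inP/(_ W Wpi)/implyP/(_ VW).
    move=> /forall_inP/(_ i iV)/forall_inP/(_ k kV)/forall_inP/(_ j jW)/forall_inP/(_ l lW).
    by rewrite ij jk kl.
split.
  apply/and3P; split.
  - apply/eqP/setP => x; apply/finset.bigcupP/idP => [[V Vpi xV]|/cov[V]]; last by exists V.
    exact: (fintype.subsetP (sub _ Vpi)).
  - apply/finset.trivIsetP => V W Vpi Wpi VW; rewrite -finset.setI_eq0; apply/eqP/setP => x.
    rewrite !inE; apply: contraNF VW => /andP[xV xW]; apply/eqP; exact: dis xV xW.
  - by apply/negP => /ne[x]; rewrite inE.
apply/forall_inP => V Vpi; apply/forall_inP => W Wpi; apply/implyP => VW.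
apply/forall_inP => i iV; apply/forall_inP => k kV.
apply/forall_inP => j jW; apply/forall_inP => l lW.
by apply: contra VW => /and3P[ij jk kl]; apply/eqP; exact: (nc V W i j k l).
Qed.

Definition segment s t : {set 'I_n} := [set i : 'I_n | (s <= i < t)%N].

Section first_block.
Variables (o kap : 'I_n) (t : nat).
Hypothesis o_kap : (o < kap)%N.
Hypothesis kap_t : (kap < t)%N.

Let A := segment o.+1 kap.
Let B := segment kap t.

(** Let o be the first point of the segment, and kap the next point of its
    block. By non-crossing, the points strictly between them form blocks of
    their own; removing o leaves a non-crossing partition of the points from
    kap on. The two functions glue and cut are the bijection and its inverse;
    they preserve the number of blocks. *)
Definition glue_block W := if kap \in W then o |: W else W.

Definition glue (rs : {set {set 'I_n}} * {set {set 'I_n}}) :=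
  rs.1 :|: [set glue_block W | W in rs.2].

Definition cut pi := ([set V in pi | V \subset A],
  [set V :\ o | V in [set V in pi | ~~ (V \subset A)]]).

Definition next_is pi := [exists V in pi, [&& o \in V, kap \in V & [disjoint V & A]]].

Let oA : o \notin A. Proof. by rewrite inE ltnn. Qed.
Let oB : o \notin B. Proof. by rewrite inE leqNgt o_kap. Qed.
Let kB : kap \in B. Proof. by rewrite inE leqnn. Qed.

Let glue_blockP W x : reflect (x \in W \/ (x = o /\ kap \in W)) (x \in glue_block W).
Proof.
rewrite /glue_block; case: ifPn => kW; last first.
  by apply: (iffP idP) => [xW|[//|[]//]]; left.
rewrite finset.in_setU1; apply: (iffP orP) => [[/eqP ->|xW]|[xW|[-> _]]].
- by right.
- by left.
- by right.
- by left; rewrite eqxx.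
Qed.

Let glue_blockK W : W \subset B -> glue_block W :\ o = W.
Proof.
move=> WB; have oW : o \notin W by apply: contra oB; exact: (fintype.subsetP WB).
rewrite /glue_block; case: ifP => _; first by rewrite finset.setU1K.
by apply/setP => x; rewrite !inE; case: eqP => // ->; rewrite (negbTE oW).
Qed.

Let AB x : x \in A -> x \in B -> False.
Proof. by rewrite !inE => /andP[_ xk] /andP[kx _]; rewrite leqNgt xk in kx. Qed.

Let glue_block_subA W : W \subset B -> (exists x, x \in W) -> ~~ (glue_block W \subset A).
Proof.
move=> WB [x xW]; apply/negP => /fintype.subsetP/(_ x).
rewrite (introT (glue_blockP W x)); last by left.
by move=> /(_ isT) xA; apply: (AB xA); exact: (fintype.subsetP WB).
Qed.

(** A crossing of a glued block with another one can involve o only as its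
    smallest point i, and then kap can take the place of o, unless j = kap,
    in which case the two blocks meet. *)
Lemma glue_ncpart rs : ncpart A rs.1 -> ncpart B rs.2 ->
  [/\ ncpart (segment o t) (glue rs), next_is (glue rs), cut (glue rs) = rs &
      #|glue rs| = (#|rs.1| + #|rs.2|)%N].
Proof.
case: rs => rho sigma /= /ncpartP[sub1 cov1 dis1 ne1 nc1] /ncpartP[sub2 cov2 dis2 ne2 nc2].
have inB W x : W \in sigma -> x \in W -> x \in B by move=> /sub2/fintype.subsetP; apply.
have inA W x : W \in rho -> x \in W -> x \in A by move=> /sub1/fintype.subsetP; apply.
have glueA W : W \in sigma -> ~~ (glue_block W \subset A).
  by move=> Ws; apply: (glue_block_subA (sub2 _ Ws)); exact: ne2.
have glueP V : reflect (V \in rho \/ exists2 W, W \in sigma & V = glue_block W)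
    (V \in glue (rho, sigma)).
  rewrite /glue finset.in_setU /=; apply: (iffP orP) => -[h|]; [by left| |by left|].
    by move=> /imsetP[W Ws ->]; right; exists W.
  by move=> [W Ws ->]; right; apply/imsetP; exists W.
have segE x : (x \in segment o t) = [|| x == o, x \in A | x \in B].
  rewrite !inE -val_eqE /=; move: o_kap kap_t; clear; lia.
split.
- apply/ncpartP; split.
  + move=> V /glueP[Vr|[W Ws ->]]; apply/fintype.subsetP => x; rewrite segE.
      by move=> xV; rewrite (inA V x) ?orbT.
    by move=> /glue_blockP[xW|[-> _]]; rewrite ?eqxx// (inB W x)// !orbT.
  + move=> x; rewrite segE => /or3P[/eqP ->|xA|xB].
    * have [W Ws kW] := cov2 _ kB; exists (glue_block W); first by apply/glueP; right; exists W.
      by apply/glue_blockP; right.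
    * by have [W Wr xW] := cov1 _ xA; exists W => //; apply/glueP; left.
    * have [W Ws xW] := cov2 _ xB; exists (glue_block W); first by apply/glueP; right; exists W.
      by apply/glue_blockP; left.
  + move=> V V' x /glueP[Vr|[W Ws ->]] /glueP[Vr'|[W' Ws' ->]].
    * exact: dis1.
    * move=> xV /glue_blockP[xW|[xo _]]; first by case: (AB (inA _ _ Vr xV) (inB _ _ Ws' xW)).
      by move: (inA _ _ Vr xV); rewrite xo (negbTE oA).
    * move=> /glue_blockP[xW|[xo _]] xV; first by case: (AB (inA _ _ Vr' xV) (inB _ _ Ws xW)).
      by move: (inA _ _ Vr' xV); rewrite xo (negbTE oA).
    * move=> /glue_blockP[xW|[xo kW]] /glue_blockP[xW'|[xo' kW']].
      - by rewrite (dis2 W W' x).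
      - by move: (inB _ _ Ws xW); rewrite xo' (negbTE oB).
      - by move: (inB _ _ Ws' xW'); rewrite xo (negbTE oB).
      - by rewrite (dis2 W W' kap).
  + move=> V /glueP[Vr|[W Ws ->]]; first exact: ne1.
    by have [x xW] := ne2 _ Ws; exists x; apply/glue_blockP; left.
  + have ge_B W (x : 'I_n) : W \in sigma -> x \in W -> (kap <= x)%N.
      by move=> Ws xW; have := inB _ _ Ws xW; rewrite inE => /andP[].
    have lt_A W (x : 'I_n) : W \in rho -> x \in W -> (o < x < kap)%N.
      by move=> Ws xW; have := inA _ _ Ws xW; rewrite inE.
    move=> V V' i j k l /glueP[Vr|[W Ws ->]] /glueP[Vr'|[W' Ws' ->]] iV kV jV lV ij jk kl.
    * exact: (nc1 V V' i j k l).
    * have /andP[oi ik] := lt_A _ _ Vr iV; have /andP[ok kk] := lt_A _ _ Vr kV.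
      move/glue_blockP: jV => [/(ge_B _ _ Ws')|[jo _]]; last by move: ij oi; rewrite jo; clear; lia.
      by move: jk kk; clear; lia.
    * have /andP[oj jk'] := lt_A _ _ Vr' jV; have /andP[ol lk] := lt_A _ _ Vr' lV.
      move/glue_blockP: kV => [/(ge_B _ _ Ws)|[ko _]]; first by move: kl lk; clear; lia.
      by move: jk oj; rewrite ko; clear; lia.
    * have kW : k \in W.
        move/glue_blockP: kV => [//|[ko _]]; exfalso; move: jk ij; rewrite ko => jo ij.
        by move/glue_blockP: jV => [/(ge_B _ _ Ws')|[jo' _]]; move: jo o_kap; rewrite ?jo'; clear; lia.
      have jW' : j \in W'.
        move/glue_blockP: jV => [//|[jo _]]; exfalso; move: ij; rewrite jo => io.
        by move/glue_blockP: iV => [/(ge_B _ _ Ws)|[io' _]]; move: io o_kap; rewrite ?io'; clear; lia.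
      have lW' : l \in W'.
        move/glue_blockP: lV => [//|[lo _]]; exfalso; move: kl; rewrite lo => ko.
        by move: ko (ge_B _ _ Ws kW) o_kap; clear; lia.
      move/glue_blockP: iV => [iW|[io kapW]]; first by rewrite (nc2 W W' i j k l).
      have := ge_B _ _ Ws' jW'; rewrite leq_eqVlt => /orP[/eqP/val_inj kj|kj].
        by rewrite (dis2 W W' kap)// kj.
      by rewrite (nc2 W W' kap j k l).
- have [W Ws kW] := cov2 _ kB; apply/existsP; exists (glue_block W); apply/and4P; split.
  + by apply/glueP; right; exists W.
  + by apply/glue_blockP; right.
  + by apply/glue_blockP; left.
  + rewrite -finset.setI_eq0; apply/eqP/setP => x; rewrite finset.in_setI finset.in_set0.
    apply/negP => /andP[/glue_blockP[xW|[-> _]]]; last by rewrite (negbTE oA).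
    by move=> xA; apply: (AB xA); exact: inB xW.
- congr pair; apply/setP => V.
    rewrite finset.in_set; apply/andP/idP => [[/glueP[//|[W Ws ->]]]|Vr].
      by rewrite (negbTE (glueA _ Ws)).
    by split; [apply/glueP; left|exact: sub1].
  apply/imsetP/idP => [[U]|Vs].
    rewrite finset.in_set => /andP[/glueP[Ur|[W Ws ->]]]; first by rewrite sub1.
    by move=> _ ->; rewrite glue_blockK//; exact: sub2.
  exists (glue_block V); last by rewrite glue_blockK//; exact: sub2.
  by rewrite finset.in_set (glueA _ Vs) andbT; apply/glueP; right; exists V.
- rewrite /glue /= finset.cardsU.
  have -> : rho :&: [set glue_block W | W in sigma] = finset.set0.
    apply/setP => V; rewrite finset.in_setI finset.in_set0; apply/negP => /andP[Vr /imsetP[W Ws VE]].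
    by move: (glueA _ Ws); rewrite -VE sub1.
  rewrite cards0 subn0 card_in_imset// => W W' Ws Ws' e.
  by rewrite -(glue_blockK (sub2 _ Ws)) e glue_blockK//; exact: sub2.
Qed.

(** A block other than that of o and kap with points both in A and in B would
    cross it. *)
Lemma cut_ncpart pi : ncpart (segment o t) pi -> next_is pi ->
  [/\ ncpart A (cut pi).1, ncpart B (cut pi).2 & glue (cut pi) = pi].
Proof.
move=> /ncpartP[sub cov dis ne nc] /existsP[V0 /and4P[V0pi oV0 kV0 dV0]].
have V0A x : x \in V0 -> x \in A -> False.
  by move=> xV xA; rewrite (disjointFr dV0 xV) in xA.
have segE x : (x \in segment o t) = [|| x == o, x \in A | x \in B].
  rewrite !inE -val_eqE /=; move: o_kap kap_t; clear; lia.
have inseg V x : V \in pi -> x \in V -> x \in segment o t.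
  by move=> /sub/fintype.subsetP; apply.
have dich V x : V \in pi -> x \in V -> x \in A -> V \subset A.
  move=> Vpi xV xA; apply/fintype.subsetP => y yV.
  have := inseg _ _ Vpi yV; rewrite segE => /or3P[/eqP yo|//|yB].
    have VV0 : V = V0 by apply: (dis _ _ o) => //; rewrite -yo.
    by case: (V0A x) => //; rewrite -VV0.
  have [yk|yk] := eqVneq y kap.
    have VV0 : V = V0 by apply: (dis _ _ kap) => //; rewrite -yk.
    by case: (V0A x) => //; rewrite -VV0.
  have VV0 : V0 = V.
    apply: (nc V0 V o x kap y) => //; move: xA yB; rewrite !inE => /andP[]// ? ?.
    by move=> /andP[ky _]; rewrite ltn_neqAle ky andbT eq_sym.
  by case: (V0A x) => //; rewrite VV0.
have sigP V : V \in pi -> ~~ (V \subset A) -> (V :\ o) \subset B.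
  move=> Vpi VA; apply/fintype.subsetP => x; rewrite finset.in_setD1 => /andP[xo xV].
  have := inseg _ _ Vpi xV; rewrite segE (negbTE xo) /= => /orP[xA|//].
  by move: VA; rewrite (dich V x).
have oV V : V \in pi -> o \in V -> V = V0 by move=> Vpi oV; exact: (dis _ _ o).
have kV V : V \in pi -> kap \in V -> V = V0 by move=> Vpi kV; exact: (dis _ _ kap).
have cut2P U : reflect (exists V, [/\ V \in pi, ~~ (V \subset A) & U = V :\ o]) (U \in (cut pi).2).
  apply: (iffP imsetP) => [[V]|[V [Vpi VA ->]]].
    by rewrite finset.in_set => /andP[Vpi VA ->]; exists V.
  by exists V => //; rewrite finset.in_set Vpi.
split.
- apply/ncpartP; split => /=.
  + by move=> V; rewrite finset.in_set => /andP[].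
  + move=> x xA; have /cov[V Vpi xV] : x \in segment o t by rewrite segE xA orbT.
    by exists V => //; rewrite finset.in_set Vpi (dich V x).
  + by move=> V W x; rewrite !finset.in_set => /andP[Vpi _] /andP[Wpi _]; exact: dis.
  + by move=> V; rewrite finset.in_set => /andP[Vpi _]; exact: ne.
  + by move=> V W i j k l; rewrite !finset.in_set => /andP[Vpi _] /andP[Wpi _]; exact: nc.
- apply/ncpartP; split.
  + by move=> U /cut2P[V [Vpi VA ->]]; exact: sigP.
  + move=> x xB; have /cov[V Vpi xV] : x \in segment o t by rewrite segE xB !orbT.
    exists (V :\ o); last by rewrite finset.in_setD1 xV andbT; apply: contraNneq oB => <-.
    apply/cut2P; exists V; split => //; apply/negP => /fintype.subsetP/(_ x xV) xA.
    exact: AB xA xB.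
  + move=> U U' x /cut2P[V [Vpi VA ->]] /cut2P[W [Wpi WA ->]].
    by rewrite !finset.in_setD1 => /andP[_ xV] /andP[_ xW]; rewrite (dis V W x).
  + move=> U /cut2P[V [Vpi VA ->]].
    have [oV'|oV'] := boolP (o \in V).
      exists kap; rewrite finset.in_setD1 (oV V)// kV0 andbT.
      by rewrite -val_eqE /= gtn_eqF.
    have [x xV] := ne _ Vpi; exists x; rewrite finset.in_setD1 xV andbT.
    by apply: contraNneq oV' => <-.
  + move=> U U' i j k l /cut2P[V [Vpi VA ->]] /cut2P[W [Wpi WA ->]].
    rewrite !finset.in_setD1 => /andP[_ iV] /andP[_ kV'] /andP[_ jW] /andP[_ lW] ij jk kl.
    by rewrite (nc V W i j k l).
- have glueK V : V \in pi -> ~~ (V \subset A) -> glue_block (V :\ o) = V.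
    move=> Vpi VA; rewrite /glue_block finset.in_setD1.
    have -> : kap != o by rewrite -val_eqE /= gtn_eqF.
    case: ifPn => /= kV'; first by rewrite finset.setD1K// (kV V).
    apply/setP => x; rewrite finset.in_setD1; case: eqP => //= ->.
    by apply/esym/negP => /(oV _ Vpi) VV0; rewrite VV0 kV0 in kV'.
  apply/setP => V; rewrite /glue finset.in_setU finset.in_set; apply/orP/idP => [[/andP[]//|]|Vpi].
    by move=> /imsetP[U /cut2P[W [Wpi WA ->]] ->]; rewrite glueK.
  have [VA|VA] := boolP (V \subset A); [left|right]; first by rewrite Vpi.
  by apply/imsetP; exists (V :\ o); [apply/cut2P; exists V|rewrite glueK].
Qed.
End first_block.
End noncrossing_partitions.

(** * Non-crossing partitions counted by their number of blocks *)
Section noncrossing_sums.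
Local Open Scope set_scope.
Variables (C : comNzRingType) (lambda : C) (n : nat).
Implicit Types (pi rho sigma : {set {set 'I_n}}) (o kap : 'I_n).

Definition nc_sum s t : C := \sum_(pi | ncpart (segment n s t) pi) lambda ^+ #|pi|.

Lemma nc_sum_next o kap t : (o < kap)%N -> (kap < t)%N ->
  \sum_(pi | ncpart (segment n o t) pi && next_is o kap pi) lambda ^+ #|pi| =
  nc_sum o.+1 kap * nc_sum kap t.
Proof.
move=> ok kt.
rewrite (reindex_onto (glue o kap) (cut o kap)); last first.
  by move=> pi /andP[h1 h2]; have [] := cut_ncpart ok kt h1 h2.
rewrite /nc_sum big_distrlr /= pair_big /=.
apply: eq_big => [rs|rs].
  apply/idP/idP => [/andP[/andP[h1 h2] /eqP e]|/andP[h1 h2]].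
    by have [c1 c2 _] := cut_ncpart ok kt h1 h2; rewrite -e c1 c2.
  by have [-> -> -> _] := glue_ncpart ok kt h1 h2; rewrite eqxx.
move=> /andP[/andP[h1 h2] /eqP e].
have [c1 c2 _] := cut_ncpart ok kt h1 h2; rewrite e in c1 c2.
by have [_ _ _ ->] := glue_ncpart ok kt c1 c2; rewrite exprD.
Qed.

Lemma segment_recl o t x : (o < t)%N ->
  (x \in segment n o t) = (x == o) || (x \in segment n o.+1 t).
Proof. by rewrite !inE -val_eqE /=; clear; lia. Qed.

Lemma ncpart_add_singleton o t rho : (o < t)%N ->
  ncpart (segment n o.+1 t) rho ->
  ncpart (segment n o t) ([set o] |: rho) /\ [set o] \notin rho.
Proof.
move=> ot /ncpartP[sub cov dis ne nc].
have oA : o \notin segment n o.+1 t by rewrite inE ltnn.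
have oW W : W \in rho -> o \notin W.
  by move=> /sub/fintype.subsetP h; apply: contra oA => /h.
have orho : [set o] \notin rho by apply/negP => /oW; rewrite !inE eqxx.
split => //; apply/ncpartP; split.
- move=> V /setU1P[->|Vr]; apply/fintype.subsetP => x; rewrite segment_recl//.
    by rewrite inE => ->.
  by move=> xV; rewrite (fintype.subsetP (sub _ Vr)) ?orbT.
- move=> x; rewrite segment_recl// => /orP[/eqP ->|/cov[W Wr xW]].
    by exists [set o]; rewrite !inE eqxx.
  by exists W => //; rewrite finset.in_setU1 Wr orbT.
- move=> V W x /setU1P[->|Vr] /setU1P[->|Wr] //; rewrite ?finset.in_set1.
  + by move=> /eqP ->; rewrite (negbTE (oW _ Wr)).
  + by move=> + /eqP xo; rewrite xo (negbTE (oW _ Vr)).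
  + exact: dis.
- by move=> V /setU1P[->|/ne//]; exists o; rewrite inE.
- move=> V W i j k l /setU1P[->|Vr] /setU1P[->|Wr] //; rewrite ?finset.in_set1.
  + by move=> /eqP -> /eqP -> _ _; clear; lia.
  + by move=> _ _ /eqP -> /eqP ->; clear; lia.
  + exact: nc.
Qed.

Lemma ncpart_remove_singleton o t pi : (o < t)%N ->
  ncpart (segment n o t) pi -> [set o] \in pi ->
  ncpart (segment n o.+1 t) (pi :\ [set o]).
Proof.
move=> ot /ncpartP[sub cov dis ne nc] opi; apply/ncpartP; split.
- move=> V; rewrite finset.in_setD1 => /andP[Vo Vpi]; apply/fintype.subsetP => x xV.
  have := fintype.subsetP (sub _ Vpi) _ xV; rewrite segment_recl// => /orP[/eqP xo|//].
  have xo' : x \in [set o] by rewrite inE xo.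
  by rewrite (dis V [set o] x Vpi opi xV xo') eqxx in Vo.
- move=> x xA; have /cov[V Vpi xV] : x \in segment n o t by rewrite segment_recl// xA orbT.
  exists V => //; rewrite finset.in_setD1 Vpi andbT; apply/negP => /eqP Vo.
  by move: xV xA; rewrite Vo !inE => /eqP ->; rewrite ltnn.
- by move=> V W x; rewrite !finset.in_setD1 => /andP[_ Vpi] /andP[_ Wpi]; exact: dis.
- by move=> V; rewrite finset.in_setD1 => /andP[_ /ne].
- by move=> V W i j k l; rewrite !finset.in_setD1 => /andP[_ Vpi] /andP[_ Wpi]; exact: nc.
Qed.

Lemma nc_sum_singleton o t : (o < t)%N ->
  \sum_(pi | ncpart (segment n o t) pi && ([set o] \in pi)) lambda ^+ #|pi| =
  lambda * nc_sum o.+1 t.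
Proof.
move=> ot; rewrite (reindex_onto (fun rho => [set o] |: rho) (fun pi => pi :\ [set o])); last first.
  by move=> pi /andP[_ opi]; rewrite finset.setD1K.
rewrite /nc_sum mulr_sumr; apply: eq_big => [rho|rho].
  apply/idP/idP => [/andP[/andP[h1 h2] /eqP <-]|h].
    exact: ncpart_remove_singleton.
  have [-> orho] := ncpart_add_singleton ot h.
  by rewrite finset.setU1K// eqxx finset.in_setU1 eqxx.
move=> /andP[/andP[h1 h2] /eqP e].
have h := ncpart_remove_singleton ot h1 h2; rewrite e in h.
by have [_ orho] := ncpart_add_singleton ot h; rewrite cardsU1 orho exprS.
Qed.

(** The first point is alone in its block, or has there a unique successor. *)
Lemma ncpart_first_block o t pi : (o < t)%N -> ncpart (segment n o t) pi ->
  lambda ^+ #|pi| = (if [set o] \in pi then lambda ^+ #|pi| else 0) +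
   \sum_(kap : 'I_n | (o < kap < t)%N) if next_is o kap pi then lambda ^+ #|pi| else 0.
Proof.
move=> ot /ncpartP[sub cov dis ne nc].
have [V Vpi oV] : exists2 V, V \in pi & o \in V by apply: cov; rewrite inE leqnn.
have VE W : W \in pi -> o \in W -> W = V by move=> Wpi oW; exact: dis oW oV.
have nextE kap : next_is o kap pi = (kap \in V) && [disjoint V & segment n o.+1 kap].
  apply/existsP/andP => [[W /and4P[Wpi oW kW dW]]|[kV dV]].
    by rewrite -(VE W).
  by exists V; rewrite Vpi oV kV.
case: ifPn => [opi|opi].
  rewrite big1 ?addr0// => kap /andP[ok _]; rewrite nextE -(VE _ opi) ?inE//.
  by rewrite -val_eqE /= gtn_eqF.
have [k0 k0V] : exists k0, (k0 \in V) && (o < k0)%N.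
  apply/existsP; apply: contraT; rewrite negb_exists => /forallP h.
  case/negP: opi; suff <- : V = [set o] by [].
  apply/setP => x; rewrite inE; apply/idP/eqP => [xV|->//].
  have := fintype.subsetP (sub _ Vpi) _ xV; rewrite inE => /andP[ox _].
  by have := h x; rewrite xV /= -leqNgt => xo; apply/val_inj/eqP; rewrite eqn_leq xo ox.
pose kap := [arg min_(i < k0 | (i \in V) && (o < i)%N) (i : nat)].
have [kV ok kmin] : [/\ kap \in V, (o < kap)%N &
    forall j : 'I_n, j \in V -> (o < j)%N -> (kap <= j)%N].
  rewrite /kap; case: arg_minnP => // i /andP[iV oi] h; split => // j jV oj.
  by apply: h; rewrite jV oj.
have kt : (kap < t)%N.
  by have := fintype.subsetP (sub _ Vpi) _ kV; rewrite inE => /andP[].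
have dV : (kap \in V) && [disjoint V & segment n o.+1 kap].
  rewrite kV disjoint_subset; apply/fintype.subsetP => x xV; rewrite !inE.
  by apply/negP => /andP[ox]; rewrite ltnNge kmin.
rewrite add0r (bigD1 kap) ?ok ?kt//= nextE dV.
rewrite big1 ?addr0// => j /andP[/andP[oj jt] jk]; rewrite nextE.
case: ifPn => // /andP[jV /disjointFr/(_ kV)]; rewrite inE ok /=.
suff -> : (kap < j)%N by [].
by rewrite ltn_neqAle kmin// andbT; apply: contra jk => /eqP/val_inj ->.
Qed.

Lemma nc_sum_rec o t : (o < t)%N ->
  nc_sum o t = lambda * nc_sum o.+1 t +
    \sum_(kap : 'I_n | (o < kap < t)%N) nc_sum o.+1 kap * nc_sum kap t.
Proof.
move=> ot; rewrite {1}/nc_sum.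
under eq_bigr => pi hpi do rewrite (ncpart_first_block ot hpi).
rewrite big_split/= -big_mkcondr nc_sum_singleton//; congr (_ + _).
rewrite exchange_big /=; apply: eq_bigr => kap /andP[ok kt].
by rewrite -big_mkcondr nc_sum_next.
Qed.

Lemma nc_sum_empty s : nc_sum s s = 1.
Proof.
have s0 : segment n s s = finset.set0.
  by apply/setP => x; rewrite !inE; apply/negP => /andP[h1]; rewrite ltnNge h1.
rewrite /nc_sum (big_pred1 finset.set0); first by rewrite cards0.
move=> pi; rewrite s0; apply/idP/eqP => [/ncpartP[sub _ _ ne _]|->].
  apply/setP => V; rewrite inE; apply/negP => Vpi.
  have [x xV] := ne _ Vpi; have := fintype.subsetP (sub _ Vpi) _ xV.
  by rewrite inE.
by apply/ncpartP; split => [V|x|V W x|V|V W i j k l]; rewrite inE.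
Qed.

(** The recursion for nc_sum runs over segments, but its solution depends on
    their length only; the summand M c.+1 * M (l.-1 - c) has its index
    reversed with respect to the position of the successor. *)
Lemma nc_sum_moments (M : nat -> C) : M 0%N = 1 ->
  (forall l, M l.+1 = lambda * M l + \sum_(c < l) M c.+1 * M (l.-1 - c)%N) ->
  forall s t, (s <= t <= n)%N -> nc_sum s t = M (t - s)%N.
Proof.
move=> M0 MS s t; have [l] := ubnP (t - s); elim: l s t => // l IH s t.
rewrite ltnS => tsl /andP[st tn].
move: (st); rewrite leq_eqVlt => /orP[/eqP <-|lt_st].
  by rewrite subnn nc_sum_empty.
have sn : (s < n)%N by exact: leq_trans tn.
have -> : s = Ordinal sn :> nat by [].
rewrite nc_sum_rec//=.
have [r ts] : exists r, (t - s = r.+1)%N.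
  by exists (t - s).-1; rewrite prednK// subn_gt0.
have tE : t = (s + r.+1)%N by rewrite -ts subnKC.
rewrite ts MS IH; [|lia|lia].
congr (_ * M _ + _); first lia.
transitivity (\sum_(k < n | (s < k < t)%N) M (k - s.+1)%N * M (t - k)%N).
  by apply: eq_bigr => k /andP[sk kt]; rewrite !IH//; lia.
rewrite -(big_mkord (fun k => s < k < t)%N (fun k => M (k - s.+1)%N * M (t - k)%N)).
rewrite -(big_nat_widen 0 t n (fun k => s < k)%N)// -(big_nat_widenl s.+1 0 t xpredT)//.
rewrite -{1}[s.+1]add0n big_addn big_mkord.
have -> : (t - s.+1 = r)%N by lia.
rewrite (reindex_inj rev_ord_inj) /=; apply: eq_bigr => c _.
by rewrite mulrC; congr (M _ * M _); have := ltn_ord c; lia.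
Qed.

End noncrossing_sums.

(** * The limit space *)
Section gen_subalgebra_poly.
Variables (C : comNzRingType) (A : algType C).

(** Polynomials in a form a subalgebra that contains a. *)
Lemma gen_subalgebra_horner (a b : A) : gen_subalgebra a b ->
  exists p : {poly C}, b = horner_alg a p.
Proof.
pose S : set A := [set y | exists p : {poly C}, y = horner_alg a p].
suff h : S b -> exists p : {poly C}, b = horner_alg a p.
  move=> /(_ S) H; apply: h; apply: H; split; last first.
    by move=> _ ->; exists 'X; rewrite horner_algX.
  split.
  - by rewrite inE; exists 1; rewrite rmorph1.
  - move=> c u v; rewrite !inE => -[p ->] [r ->].
    by exists (c *: p + r); rewrite rmorphD -mul_polyC rmorphM /= horner_algC mulr_algl.
  - move=> u v; rewrite !inE => -[p ->] [r ->].
    by exists (p * r); rewrite rmorphM.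
by [].
Qed.
End gen_subalgebra_poly.

Section limit_space.
Variables (R : realType) (A : word_algebra R[i]) (q : bool -> R[i]).

Definition limit_space : ncProbSpace R :=
  @NcProbSpace R A (wa_lin A (limit_moment q)) (phi1 A q).

Definition limit_var (i : bool) : limit_space := wa_word A [:: i].

Lemma limit_space_word w : nc_state limit_space (wa_word A w) = limit_moment q w.
Proof. exact: wa_lin_word. Qed.

Lemma limit_var_free : free_elements (pair_fun (limit_var false) (limit_var true)).
Proof.
move=> k i a k0 Ha a0 alt.
have pE j : pair_fun (limit_var false) (limit_var true) j = limit_var j by case: j.
have /choice[p Hp] : forall j, exists p : {poly R[i]}, a j = peval A (i j) p.
  by move=> j; have := Ha j; rewrite pE => /gen_subalgebra_horner.
pose s := [seq (i j, p j) | j <- enum 'I_k].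
have -> : \prod_(j < k) a j = pevals A s.
  have eE : enum 'I_k = index_enum 'I_k by rewrite enumT [index_enum _]unlock.
  by rewrite /pevals big_map eE; apply: eq_bigr => j _; rewrite Hp.
have ss : size s = k by rewrite size_map size_enum_ord.
apply: (centered_alternating_vanishes (q := q)); first by rewrite ss.
  have x0 : 'I_k := Ordinal k0.
  rewrite /alternating; apply/(sortedP (i x0, p x0)) => c; rewrite ss => ck.
  have ck' : (c < k)%N := ltnW ck.
  have sE : size (enum 'I_k) = k by have := ss; rewrite size_map.
  have nE e : (e < k)%N -> nth (i x0, p x0) s e = (i (nth x0 (enum 'I_k) e), p (nth x0 (enum 'I_k) e)).
    by move=> ek; apply: nth_map; rewrite sE.
  rewrite (nE _ ck) (nE _ ck').
  apply/eqP; apply: (alt (nth x0 (enum 'I_k) c) (nth x0 (enum 'I_k) c.+1)).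
  by rewrite (nth_enum_ord _ ck) (nth_enum_ord _ ck').
apply/allP => x /mapP[j _ ->] /=; rewrite -Hp; apply/eqP; exact: a0.
Qed.

Lemma splits_nseq (i : bool) l (F : seq bool -> seq bool -> R[i]) :
  \sum_(p <- splits i (nseq l i)) F p.1 p.2 =
  \sum_(c < l) F (nseq c i) (nseq (l.-1 - c) i).
Proof.
elim: l F => [|l IH] F /=; first by rewrite big_nil big_ord0.
rewrite eqxx big_cons big_map big_ord_recl /= subn0; congr (_ + _).
rewrite (IH (fun a b => F (i :: a) b)); apply: eq_bigr => c _.
by rewrite /= /bump /= -subn1 -subnDA add1n.
Qed.

Lemma limit_moment_power i l : limit_moment q (nseq l.+1 i) =
  q i * limit_moment q (nseq l i) +
  \sum_(c < l) limit_moment q (nseq c.+1 i) * limit_moment q (nseq (l.-1 - c) i).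
Proof.
rewrite [nseq l.+1 i]/= limit_moment_cons.
rewrite (splits_nseq i l (fun a b => limit_moment q (rcons a i) * limit_moment q b)).
have rE c : rcons (nseq c i) i = nseq c.+1 i by elim: c => //= c ->.
by congr (_ + _); apply: eq_bigr => c _; rewrite rE.
Qed.

(** The moments of the letter i satisfy the recursion for the sum of
    lambda^(number of blocks), since a word of equal letters splits at each
    of its positions. *)
Lemma limit_var_poisson i (lambda : R) : 0 < lambda -> q i = lambda%:C%C ->
  free_poisson lambda (limit_var i).
Proof.
move=> l0 qi; split => //.
exists (cumulant (nc_state limit_space)); split.
  split; first by move=> n; exact: cumulant_rec_multilinear.
  by move=> n a n0; exact: moment_cumulant.
apply: constant_cumulant => n n0.
have -> : limit_var i ^+ n = wa_word A (nseq n i).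
  elim: (n) => [|l IH]; first by rewrite expr0 wa_word_nil.
  by rewrite exprS IH -wa_word_cat.
have e : nc_sum lambda%:C%C n 0 n = limit_moment q (nseq n i).
  rewrite (@nc_sum_moments _ _ _ (fun l => limit_moment q (nseq l i))) ?subn0//.
  by move=> l; rewrite limit_moment_power qi.
  by rewrite leqnn.
transitivity (limit_moment q (nseq n i)); first exact: limit_space_word.
rewrite -e; apply: eq_bigl => pi; rewrite /ncpart /NC.
congr (finset.partition _ _ && _).
by apply/setP => x; rewrite !inE ltn_ord.
Qed.

End limit_space.

Lemma rmorph_limit_moment (S S' : pzSemiRingType) (f : {rmorphism S -> S'}) q w :
  f (limit_moment q w) = limit_moment (f \o q) w.
Proof.
rewrite /limit_moment; move: (size w) => k.
elim: k w => [|k IH] [|i w] /=; rewrite ?rmorph1 ?rmorph0//.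
rewrite rmorphD rmorphM rmorph_sum IH; congr (_ + _).
by apply: eq_bigr => p _; rewrite rmorphM !IH.
Qed.

(** In the factorisation B = U V through the row space, B B = B forces V U = 1,
    and the trace of U V is that of V U. *)
Lemma mxtrace_idempotent (F : fieldType) n (B : 'M[F]_n) :
  B *m B = B -> \tr B = (\rank B)%:R.
Proof.
move=> BB.
have CR := mulmx_base B.
have h : row_base B *m col_base B = 1%:M.
  apply: (row_free_inj (row_base_free B)); apply: (row_full_inj (col_base_full B)).
  rewrite mul1mx; transitivity ((col_base B *m row_base B) *m (col_base B *m row_base B)).
    by rewrite !mulmxA.
  by rewrite CR BB.
by rewrite -{1}(mulmx_base B) mxtrace_mulC h mxtrace1.
Qed.

Section complex_embedding.
Variable R : realType.

Lemma cvg_real_complex (f : nat -> R) (l : R) : f n @[n --> \oo] --> l ->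
  (f n)%:C%C @[n --> \oo] --> (l%:C%C : R[i]^o).
Proof.
move=> fl; suff H (e : R[i]) : 0 < e -> \forall n \near \oo, `|l%:C%C - (f n)%:C%C| < e.
  by apply/(@cvgrPdist_lt R[i] R[i]^o) => e; exact: H.
move=> e0.
have [eR Re0] : (complex.Re e)%:C%C = e /\ 0 < complex.Re e.
  case: e e0 => a b; rewrite ltcE /= => /andP[/eqP b0 a0]; split => //.
  by apply/eqP; rewrite eq_complex /= eqxx /= b0.
have /cvgrPdist_lt/(_ _ Re0) h := fl.
near=> n.
rewrite -eR -rmorphB /= normc_def /= expr0n addr0 sqrtr_sqr ltcR.
by near: n.
Unshelve. all: by end_near. Qed.

Lemma complex_mx_mul m n p (M : 'M[R]_(m, n)) (N : 'M[R]_(n, p)) :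
  complex_mx (M *m N) = complex_mx M *m complex_mx N.
Proof. exact: map_mxM. Qed.

End complex_embedding.

Section state_of_words.
Context d (T : measurableType d) (R : realType) (P : probability T R).
Context (n m : nat) (X : T -> 'M[R]_(n, m)) (D : bool -> 'M[R]_n).
Hypothesis hX : iid_standard_gaussian_rows P X.

Lemma prod_complex_wish w u :
  \prod_(i <- u) complex_mx (wish D (X w) i) = complex_mx (wmx D (X w) u).
Proof.
elim: u => [|i u IH]; first by rewrite big_nil /complex_mx map_mx1.
by rewrite big_cons IH /= complex_mx_mul.
Qed.

(** The state is linear over the complex numbers, while the normalised traces
    of words are real; real and imaginary parts of the coefficients are
    treated separately because expectations are real. *)
Lemma mx_state_word (Q : ncpoly R[i] bool) :
  mx_state P (fun w => ncpoly_eval (@scalar_mx R[i] m)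
      (fun i => complex_mx (wish D (X w) i)) Q) =
  \sum_(cu <- Q) cu.1 * (mean_ntrs P X D [:: cu.2])%:C%C.
Proof.
have trE w : m%:R^-1 * \tr (ncpoly_eval (@scalar_mx R[i] m)
      (fun i => complex_mx (wish D (X w) i)) Q) =
    \sum_(cu <- Q) cu.1 * (ntrs D (X w) [:: cu.2])%:C%C.
  rewrite /ncpoly_eval raddf_sum mulr_sumr; apply: eq_bigr => cu _ /=.
  rewrite prod_complex_wish -[X in \tr X]/(cu.1%:M *m complex_mx (wmx D (X w) cu.2)).
  rewrite mul_scalar_mx linearZ /= mulrCA; congr (_ * _).
  rewrite /ntrs big_seq1 /ntr rmorphM fmorphV rmorph_nat; congr (_ * _).
  by rewrite /complex_mx trace_map_mx.
have aE := ntrs_all_moments D hX.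
have ReE w : complex.Re (\sum_(cu <- Q) cu.1 * (ntrs D (X w) [:: cu.2])%:C%C) =
    \sum_(cu <- Q) complex.Re cu.1 * ntrs D (X w) [:: cu.2].
  rewrite raddf_sum; apply: eq_bigr => -[[a b] u] _ /=.
  by rewrite mulr0 subr0.
have ImE w : complex.Im (\sum_(cu <- Q) cu.1 * (ntrs D (X w) [:: cu.2])%:C%C) =
    \sum_(cu <- Q) complex.Im cu.1 * ntrs D (X w) [:: cu.2].
  rewrite raddf_sum; apply: eq_bigr => -[[a b] u] _ /=.
  by rewrite mulr0 add0r.
have mE (c : R[i] * seq bool -> R) :
   fine ('E_P[fun w => (\sum_(cu <- Q) c cu * ntrs D (X w) [:: cu.2])%R])%E =
   \sum_(cu <- Q) c cu * mean_ntrs P X D [:: cu.2].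
  rewrite unlock -/(Rintegral _ _ _) mean_sum; last by move=> cu; exact: all_momentsZ.
  by apply: eq_bigr => cu _; rewrite meanZ.
rewrite /mx_state /cexpectation.
have -> : (fun w => complex.Re (m%:R^-1 * \tr (ncpoly_eval (@scalar_mx R[i] m)
      (fun i => complex_mx (wish D (X w) i)) Q))) =
    (fun w => \sum_(cu <- Q) complex.Re cu.1 * ntrs D (X w) [:: cu.2]).
  by apply/funext => w; rewrite trE ReE.
have -> : (fun w => complex.Im (m%:R^-1 * \tr (ncpoly_eval (@scalar_mx R[i] m)
      (fun i => complex_mx (wish D (X w) i)) Q))) =
    (fun w => \sum_(cu <- Q) complex.Im cu.1 * ntrs D (X w) [:: cu.2]).
  by apply/funext => w; rewrite trE ImE.
rewrite !mE; apply/eqP; rewrite eq_complex /= !raddf_sum /=.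
apply/andP; split; apply/eqP; apply: eq_bigr => -[[a b] u] _ /=.
  by rewrite mulr0 subr0.
by rewrite mulr0 add0r.
Qed.
End state_of_words.

Lemma cvg_linear_combination (K : numFieldType) (U : Type) (Q : seq (K * U))
    (f : U -> nat -> K) (l : U -> K) :
  (forall u, f u n @[n --> \oo] --> (l u : K^o)) ->
  \sum_(cu <- Q) cu.1 * f cu.2 n @[n --> \oo] -->
  (\sum_(cu <- Q) cu.1 * l cu.2 : K^o).
Proof.
move=> fl; elim: Q => [|[c u] Q IH].
  rewrite big_nil.
  have -> : (fun n => \sum_(cu <- [::]) cu.1 * f cu.2 n) = (fun=> 0 : K^o).
    by apply/funext => n; rewrite big_nil.
  exact: (cvg_cst (0 : K^o)).
rewrite big_cons.
have -> : (fun n => \sum_(cu <- (c, u) :: Q) cu.1 * f cu.2 n) =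
    (fun n => c * f u n + \sum_(cu <- Q) cu.1 * f cu.2 n : K^o).
  by apply/funext => n; rewrite big_cons.
apply: (@cvgD K K^o) IH.
by apply: (@cvgM K) (fl u); exact: (cvg_cst (c : K^o)).
Qed.

Theorem proposition3p7 (R : realType) (d : nat -> measure_display)
    (T : forall n, measurableType (d n)) (P : forall n, probability (T n) R)
    (m : nat -> nat) (X : forall n, T n -> 'M[R]_(n, m n))
    (B : forall n, 'M[R]_n) (p : R)
    (m_gt0 : forall n, (0 < m n)%N)
    (m_ratio : (m n)%:R / n%:R @[n --> \oo] --> (1 : R))
    (X_rows : forall n, iid_standard_gaussian_rows (P n) (X n))
    (B_sym : forall n, (B n)^T = B n)
    (B_idem : forall n, B n *m B n = B n)
    (p01 : 0 < p < 1)
    (B_rank : (\rank (B n))%:R / n%:R @[n --> \oo] --> p) :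
  exists (A : ncProbSpace R) (a b : A),
    [/\ free_elements (pair_fun a b),
        free_poisson p a,
        free_poisson (1 - p) b &
        converges_jointly P
          (fun n w => n%:R^-1 *: ((X n w)^T *m B n *m X n w))
          (fun n w => n%:R^-1 *: ((X n w)^T *m (1%:M - B n) *m X n w))
          a b].
Proof.
have /andP[p0 p1] := p01.
pose q (i : bool) : R := if i then 1 - p else p.
pose qC (i : bool) : R[i] := (q i)%:C%C.
(* The letter false stands for B and true for its complement; these are
   orthogonal projections with product zero. *)
pose D n (i : bool) : 'M[R]_n := if i then 1%:M - B n else B n.
have Dsym n i : (D n i)^T = D n i by case: i; rewrite /= ?linearB/= ?trmx1 B_sym.
have Dorth n i j : D n i *m D n j = if i == j then D n i else 0.
  case: i j => -[] /=.
  - by rewrite mulmxBr mulmx1 mulmxBl mul1mx B_idem subrr subr0.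
  - by rewrite mulmxBl mul1mx B_idem subrr.
  - by rewrite mulmxBr mulmx1 B_idem subrr.
  - exact: B_idem.
have trB n : \tr (B n) / n%:R = (\rank (B n))%:R / n%:R.
  by rewrite mxtrace_idempotent.
have Dtr i : \tr (D n i) / n%:R @[n --> \oo] --> q i.
  case: i => /=; last by under eq_fun do rewrite trB.
  apply: (@cvg_trans _ ((1 - (\rank (B n))%:R / n%:R) @[n --> \oo])); last first.
    by apply: cvgB => //; exact: cvg_cst.
  (* The normalised trace of the identity is 1 only for n > 0. *)
  apply: near_eq_cvg; near=> n.
  have n0 : n%:R != 0 :> R by rewrite pnatr_eq0 -lt0n; near: n; exact: nbhs_infty_gt.
  by rewrite linearB /= mxtrace1 mulrBl divff// trB.
pose A := free_word_algebra R[i].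
exists (limit_space A qC), (limit_var A qC false), (limit_var A qC true); split.
- exact: limit_var_free.
- exact: limit_var_poisson.
- by apply: limit_var_poisson => //; rewrite subr_gt0.
move=> Q.
have stE n : mx_state (P n) (fun w => ncpoly_eval (@scalar_mx R[i] (m n))
     (pair_fun (complex_mx (n%:R^-1 *: ((X n w)^T *m B n *m X n w)))
               (complex_mx (n%:R^-1 *: ((X n w)^T *m (1%:M - B n) *m X n w)))) Q) =
   \sum_(cu <- Q) cu.1 * (mean_ntrs (P n) (X n) (D n) [:: cu.2])%:C%C.
  rewrite -(mx_state_word (D n) (X_rows n) Q); congr mx_state; apply/funext => w.
  by congr ncpoly_eval; apply/funext => -[].
have limE : nc_state (limit_space A qC) (ncpoly_eval (in_alg (limit_space A qC))
     (pair_fun (limit_var A qC false) (limit_var A qC true)) Q) =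
   \sum_(cu <- Q) cu.1 * (limit_moment q cu.2)%:C%C.
  rewrite /ncpoly_eval linear_sum; apply: eq_bigr => cu _ /=.
  have -> : \prod_(i <- cu.2) pair_fun (limit_var A qC false) (limit_var A qC true) i =
      wa_word A cu.2 :> limit_space A qC.
    elim: cu.2 => [|i u IH]; first by rewrite big_nil wa_word_nil.
    by rewrite big_cons IH -[i :: u]cat1s wa_word_cat; case: i.
  rewrite mulr_algl linearZ /=; congr (_ * _).
  by rewrite limit_space_word; have := rmorph_limit_moment (real_complex R) q cu.2.
have -> : (fun n => mx_state (P n) (fun w => ncpoly_eval (@scalar_mx R[i] (m n))
     (pair_fun (complex_mx (n%:R^-1 *: ((X n w)^T *m B n *m X n w)))
               (complex_mx (n%:R^-1 *: ((X n w)^T *m (1%:M - B n) *m X n w)))) Q)) =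
   (fun n => \sum_(cu <- Q) cu.1 * (mean_ntrs (P n) (X n) (D n) [:: cu.2])%:C%C).
  exact/funext.
rewrite limE.
apply: (@cvg_linear_combination R[i] (seq bool) Q
  (fun u n => (mean_ntrs (P n) (X n) (D n) [:: u])%:C%C)
  (fun u => (limit_moment q u)%:C%C)) => u.
apply: cvg_real_complex.
have := @mean_ntrs_cvg R d T P m X D q m_gt0 m_ratio X_rows Dsym Dorth Dtr [:: u].
by rewrite big_seq1.
Unshelve. all: by end_near. Qed.
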